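(* Let $K$ be a field, let $E$ and $F$ be finite graphs with no sinks, and let $A_E$ and $A_F$ be their adjacency matrices. Then $A_E$ is shift equivalent to $A_F$ if and only if there is an order preserving $\mathbb Z[x,x^{-1}]$-module isomorphism $K_0^{\mathrm{gr}}(\mathcal L(E))\cong K_0^{\mathrm{gr}}(\mathcal L(F))$.
   Context: Graphs are directed graphs $E=(E^0,E^1,r,s)$ with vertex set $E^0$, edge set $E^1$, and range and source maps $r,s:E^1\to E^0$. Finite means $E^0$ and $E^1$ are finite. A sink is a vertex emitting no edge. The adjacency matrix $A_E$ has $(i,j)$ entry the number of edges from the $i$-th to the $j$-th vertex, for a fixed ordering of $E^0$. Square nonnegative integer matrices $A$ and $B$ (possibly of different sizes) are shift equivalent if there are nonnegative integer matrices $R,S$ and an integer $l\geq 1$ with $A^l=RS$, $B^l=SR$, $AR=RB$ and $SA=BS$. The Leavitt path algebra $\mathcal L(E)$ over $K$ is the $K$-algebra generated by the sets $\{v: v\in E^0\}$, $\{\alpha:\alpha\in E^1\}$, $\{\alpha^*:\alpha\in E^1\}$ subject to: (1) $vw=\delta_{v,w}v$ for $v,w\in E^0$; (2) $s(\alpha)\alpha=\alpha r(\alpha)=\alpha$ and $r(\alpha)\alpha^*=\alpha^*s(\alpha)=\alpha^*$ for $\alpha\in E^1$; (3) $\alpha^*\beta=\delta_{\alpha,\beta}r(\alpha)$ for $\alpha,\beta\in E^1$; (4) $\sum_{\alpha\in s^{-1}(v)}\alpha\alpha^*=v$ for every $v\in E^0$ with $s^{-1}(v)\neq\emptyset$. It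 is $\mathbb Z$-graded by $\deg v=0$, $\deg\alpha=1$, $\deg\alpha^*=-1$; for finite $E$ it is unital with identity $\sum_{v\in E^0}v$. For a unital $\mathbb Z$-graded ring $R$, $K_0^{\mathrm{gr}}(R)$ is the group completion of the monoid $\mathcal V^{\mathrm{gr}}(R)$ (under direct sum) of graded isomorphism classes $[P]$ of graded finitely generated projective right $R$-modules. It is a $\mathbb Z[x,x^{-1}]$-module via $x^j[P]=[P(j)]$, where $P(j)_i=P_{i+j}$. Its positive cone $K_0^{\mathrm{gr}}(R)_+$ is the image of $\mathcal V^{\mathrm{gr}}(R)$. An order preserving isomorphism means an isomorphism of pre-ordered modules, i.e. one mapping the positive cone onto the positive cone. *)

(* Defs.v *)
From HB Require Import structures.
From mathcomp Require Import all_boot all_order all_algebra.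
From mathcomp Require Import boolp classical_sets.

Set Implicit Arguments.
Unset Strict Implicit.
Unset Printing Implicit Defensive.

Import GRing.Theory.

Local Open Scope ring_scope.
Local Open Scope quotient_scope.

Record digraph := Digraph {
  vert : finType;
  edge : finType;
  src : edge -> vert;
  rng : edge -> vert }.

Definition no_sinks (E : digraph) := forall v : vert E, exists e, src e = v.

(* The ordering of the vertices is the one of [enum (vert E)]. *)
Definition adjmx (E : digraph) : 'M[nat]_#|vert E| :=
  \matrix_(i, j) #|[set e : edge E | (src e == enum_val i)
                                    && (rng e == enum_val j)]|.

Definition shift_equivalent m n (A : 'M[nat]_m) (B : 'M[nat]_n) : Prop :=
  exists (R : 'M[nat]_(m, n)) (S : 'M[nat]_(n, m)) (l : nat),
    [/\ (1 <= l)%N, A ^+ l = R *m S, B ^+ l = S *m R,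
        A *m R = R *m B & S *m A = B *m S].

Record internal_grading (V : zmodType) (C : int -> V -> Prop) : Prop :=
  InternalGrading {
    grading0 : forall i, C i 0;
    gradingB : forall i x y, C i x -> C i y -> C i (x - y);
    grading_span : forall x, exists2 s : seq (int * V),
      (forall p, p \in s -> C p.1 p.2) & x = \sum_(p <- s) p.2;
    grading_free : forall (s : seq int) (f : int -> V), uniq s ->
      (forall i, C i (f i)) -> \sum_(i <- s) f i = 0 ->
      forall i, i \in s -> f i = 0 }.

Record gradedRing := GradedRing {
  gring :> pzRingType;
  gring_comp : int -> gring -> Prop;
  gring_grading : internal_grading gring_comp;
  gring_comp1 : gring_comp 0 1;
  gring_compM : forall i j x y,
    gring_comp i x -> gring_comp j y -> gring_comp (i + j) (x * y) }.

Section Leavitt.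
Variables (K : fieldType) (E : digraph).

Inductive lpa_gen := LVert of vert E | LEdge of edge E | LGhost of edge E.

Definition lpa_deg (g : lpa_gen) : int :=
  match g with LVert _ => 0 | LEdge _ => 1 | LGhost _ => -1 end.

(* Formal expressions in the generators; there is no symbol for a unit, the
   presentation being that of a possibly non-unital algebra. *)
Inductive lpa_term :=
  | LGen of lpa_gen
  | LZero
  | LOpp of lpa_term
  | LAdd of lpa_term & lpa_term
  | LMul of lpa_term & lpa_term
  | LScale of K & lpa_term.

HB.instance Definition _ := gen_eqMixin lpa_term.
HB.instance Definition _ := gen_choiceMixin lpa_term.

Local Notation V v := (LGen (LVert v)).
Local Notation D a := (LGen (LEdge a)).
Local Notation G a := (LGen (LGhost a)).

Definition lpa_CK2_term (v : vert E) : lpa_term :=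
  foldr LAdd LZero [seq LMul (D a) (G a) | a <- enum (edge E) & src a == v].

Inductive lpa_rel : lpa_term -> lpa_term -> Prop :=
  | lr_refl t : lpa_rel t t
  | lr_sym t u : lpa_rel t u -> lpa_rel u t
  | lr_trans t u w : lpa_rel t u -> lpa_rel u w -> lpa_rel t w
  | lr_opp t t' : lpa_rel t t' -> lpa_rel (LOpp t) (LOpp t')
  | lr_add t t' u u' : lpa_rel t t' -> lpa_rel u u' ->
      lpa_rel (LAdd t u) (LAdd t' u')
  | lr_mul t t' u u' : lpa_rel t t' -> lpa_rel u u' ->
      lpa_rel (LMul t u) (LMul t' u')
  | lr_scale k t t' : lpa_rel t t' -> lpa_rel (LScale k t) (LScale k t')
  | lr_addA t u w : lpa_rel (LAdd t (LAdd u w)) (LAdd (LAdd t u) w)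
  | lr_addC t u : lpa_rel (LAdd t u) (LAdd u t)
  | lr_add0 t : lpa_rel (LAdd LZero t) t
  | lr_addN t : lpa_rel (LAdd (LOpp t) t) LZero
  | lr_mulA t u w : lpa_rel (LMul t (LMul u w)) (LMul (LMul t u) w)
  | lr_mulDl t u w : lpa_rel (LMul (LAdd t u) w) (LAdd (LMul t w) (LMul u w))
  | lr_mulDr t u w : lpa_rel (LMul t (LAdd u w)) (LAdd (LMul t u) (LMul t w))
  | lr_scaleA a b t : lpa_rel (LScale a (LScale b t)) (LScale (a * b) t)
  | lr_scale1 t : lpa_rel (LScale 1 t) t
  | lr_scaleDr a t u :
      lpa_rel (LScale a (LAdd t u)) (LAdd (LScale a t) (LScale a u))
  | lr_scaleDl a b t :
      lpa_rel (LScale (a + b) t) (LAdd (LScale a t) (LScale b t))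
  | lr_scaleAl a t u : lpa_rel (LScale a (LMul t u)) (LMul (LScale a t) u)
  | lr_scaleAr a t u : lpa_rel (LScale a (LMul t u)) (LMul t (LScale a u))
  | lr_vert v w : lpa_rel (LMul (V v) (V w)) (if v == w then V v else LZero)
  | lr_src a : lpa_rel (LMul (V (src a)) (D a)) (D a)
  | lr_rng a : lpa_rel (LMul (D a) (V (rng a))) (D a)
  | lr_rngG a : lpa_rel (LMul (V (rng a)) (G a)) (G a)
  | lr_srcG a : lpa_rel (LMul (G a) (V (src a))) (G a)
  | lr_CK1 a b : lpa_rel (LMul (G a) (D b))
                         (if a == b then V (rng a) else LZero)
  | lr_CK2 v : (exists a, src a = v) -> lpa_rel (lpa_CK2_term v) (V v).

Definition lpa_relb (t u : lpa_term) := `[< lpa_rel t u >].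

Lemma lpa_relb_refl : reflexive lpa_relb.
Proof. by move=> t; apply/asboolP/lr_refl. Qed.

Lemma lpa_relb_sym : symmetric lpa_relb.
Proof. by move=> t u; apply/asboolP/asboolP => /lr_sym. Qed.

Lemma lpa_relb_trans : transitive lpa_relb.
Proof. by move=> u t w /asboolP tu /asboolP uw; apply/asboolP/(lr_trans tu). Qed.

Canonical lpa_equiv :=
  EquivRel lpa_relb lpa_relb_refl lpa_relb_sym lpa_relb_trans.

Definition leavitt : Type := {eq_quot lpa_equiv}.
HB.instance Definition _ := Choice.on leavitt.
HB.instance Definition _ := EqQuotient.on leavitt.

Definition lpa_pi (t : lpa_term) : leavitt := \pi_leavitt t.

Lemma lpa_piP t u : lpa_pi t = lpa_pi u <-> lpa_rel t u.
Proof. by split=> [/eqmodP/asboolP|?] //; apply/eqmodP/asboolP. Qed.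

Lemma lpa_pi_surj x : exists t, x = lpa_pi t.
Proof. by exists (repr x); rewrite /lpa_pi reprK. Qed.

Lemma lpa_reprP t : lpa_rel (repr (lpa_pi t)) t.
Proof. by apply/lpa_piP; rewrite /lpa_pi reprK. Qed.

Definition lpa_add (x y : leavitt) := lpa_pi (LAdd (repr x) (repr y)).
Definition lpa_opp (x : leavitt) := lpa_pi (LOpp (repr x)).
Definition lpa_mul (x y : leavitt) := lpa_pi (LMul (repr x) (repr y)).
Definition lpa_scale (k : K) (x : leavitt) := lpa_pi (LScale k (repr x)).

Lemma lpa_addE t u : lpa_add (lpa_pi t) (lpa_pi u) = lpa_pi (LAdd t u).
Proof. by apply/lpa_piP; apply: lr_add; apply: lpa_reprP. Qed.
Lemma lpa_oppE t : lpa_opp (lpa_pi t) = lpa_pi (LOpp t).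
Proof. by apply/lpa_piP; apply: lr_opp; apply: lpa_reprP. Qed.
Lemma lpa_mulE t u : lpa_mul (lpa_pi t) (lpa_pi u) = lpa_pi (LMul t u).
Proof. by apply/lpa_piP; apply: lr_mul; apply: lpa_reprP. Qed.
Lemma lpa_scaleE k t : lpa_scale k (lpa_pi t) = lpa_pi (LScale k t).
Proof. by apply/lpa_piP; apply: lr_scale; apply: lpa_reprP. Qed.
Definition lpaE := (lpa_addE, lpa_oppE, lpa_mulE, lpa_scaleE).

Local Ltac lift := repeat (let x := fresh "x" in let t := fresh "t" in
  move=> x; first [have [t ->] := lpa_pi_surj x; clear x | move: x]);
  rewrite !lpaE; apply/lpa_piP.

Lemma lpa_addA : associative lpa_add.
Proof. lift; exact: lr_addA. Qed.
Lemma lpa_addC : commutative lpa_add.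
Proof. lift; exact: lr_addC. Qed.
Lemma lpa_add0 : left_id (lpa_pi LZero) lpa_add.
Proof. lift; exact: lr_add0. Qed.
Lemma lpa_addN : left_inverse (lpa_pi LZero) lpa_opp lpa_add.
Proof. lift; exact: lr_addN. Qed.

HB.instance Definition _ :=
  GRing.isZmodule.Build leavitt lpa_addA lpa_addC lpa_add0 lpa_addN.

Definition lpa_one : leavitt := \sum_(v : vert E) lpa_pi (V v).

Lemma lpa_mulA : associative lpa_mul.
Proof. lift; exact: lr_mulA. Qed.
Lemma lpa_mulDl : left_distributive lpa_mul lpa_add.
Proof. lift; exact: lr_mulDl. Qed.
Lemma lpa_mulDr : right_distributive lpa_mul lpa_add.
Proof. lift; exact: lr_mulDr. Qed.

Let mulDl x y z : lpa_mul (x + y) z = lpa_mul x z + lpa_mul y z.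
Proof. exact: lpa_mulDl. Qed.
Let mulDr x y z : lpa_mul x (y + z) = lpa_mul x y + lpa_mul x z.
Proof. exact: lpa_mulDr. Qed.

Lemma lpa_mul0 x : lpa_mul 0 x = 0.
Proof. by apply: (addrI (lpa_mul 0 x)); rewrite -mulDl !addr0. Qed.
Lemma lpa_mulx0 x : lpa_mul x 0 = 0.
Proof. by apply: (addrI (lpa_mul x 0)); rewrite -mulDr !addr0. Qed.
Lemma lpa_mulN x y : lpa_mul (- x) y = - lpa_mul x y.
Proof. by apply: (addrI (lpa_mul x y)); rewrite -mulDl !subrr lpa_mul0. Qed.
Lemma lpa_mulxN x y : lpa_mul x (- y) = - lpa_mul x y.
Proof. by apply: (addrI (lpa_mul x y)); rewrite -mulDr !subrr lpa_mulx0. Qed.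

Lemma lpa_mul_suml (I : Type) (r : seq I) (F : I -> leavitt) y :
  lpa_mul (\sum_(i <- r) F i) y = \sum_(i <- r) lpa_mul (F i) y.
Proof.
elim: r => [|i r IH]; first by rewrite !big_nil lpa_mul0.
by rewrite !big_cons -IH -mulDl.
Qed.
Lemma lpa_mul_sumr (I : Type) (r : seq I) (F : I -> leavitt) y :
  lpa_mul y (\sum_(i <- r) F i) = \sum_(i <- r) lpa_mul y (F i).
Proof.
elim: r => [|i r IH]; first by rewrite !big_nil lpa_mulx0.
by rewrite !big_cons -IH -mulDr.
Qed.

Let v0 : lpa_pi LZero = 0. Proof. by []. Qed.

Lemma lpa_vertM v w :
  lpa_mul (lpa_pi (V v)) (lpa_pi (V w)) = if v == w then lpa_pi (V v) else 0.
Proof.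
rewrite lpa_mulE; transitivity (lpa_pi (if v == w then V v else LZero)).
  by apply/lpa_piP/lr_vert.
by case: ifP.
Qed.

Lemma lpa_one_vert v : lpa_mul lpa_one (lpa_pi (V v)) = lpa_pi (V v).
Proof.
rewrite lpa_mul_suml (bigD1 v) //= lpa_vertM eqxx big1 ?addr0 // => w wv.
by rewrite lpa_vertM (negPf wv).
Qed.
Lemma lpa_vert_one v : lpa_mul (lpa_pi (V v)) lpa_one = lpa_pi (V v).
Proof.
rewrite lpa_mul_sumr (bigD1 v) //= lpa_vertM eqxx big1 ?addr0 // => w wv.
by rewrite lpa_vertM eq_sym (negPf wv).
Qed.

Lemma lpa_scale_addr k x y : lpa_scale k (x + y) = lpa_scale k x + lpa_scale k y.
Proof. move: x y; rewrite -[@GRing.add _]/lpa_add; lift; exact: lr_scaleDr. Qed.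
Lemma lpa_scale_addl x : {morph lpa_scale^~ x : a b / a + b}.
Proof.
move=> a b; move: x; rewrite -[@GRing.add leavitt]/lpa_add; lift.
exact: lr_scaleDl.
Qed.
Lemma lpa_scale_mull k x y :
  lpa_scale k (lpa_mul x y) = lpa_mul (lpa_scale k x) y.
Proof. move: x y; lift; exact: lr_scaleAl. Qed.
Lemma lpa_scale_mulr k x y :
  lpa_scale k (lpa_mul x y) = lpa_mul x (lpa_scale k y).
Proof. move: x y; lift; exact: lr_scaleAr. Qed.
Lemma lpa_scale_scale a b x : lpa_scale a (lpa_scale b x) = lpa_scale (a * b) x.
Proof. move: x; lift; exact: lr_scaleA. Qed.
Lemma lpa_scale_one : left_id 1 lpa_scale.
Proof. lift; exact: lr_scale1. Qed.

HB.instance Definition _ := GRing.Zmodule_isLmodule.Build K leavitt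
  lpa_scale_scale lpa_scale_one lpa_scale_addr lpa_scale_addl.

Lemma lpa_mul1 : left_id lpa_one lpa_mul.
Proof.
move=> x; have [t ->] := lpa_pi_surj x.
elim: t => [g||t IH|t IHt u IHu|t IHt u IHu|k t IH].
- case: g => [v|a|a]; first exact: lpa_one_vert.
  + rewrite -[in LHS]((lpa_piP _ _).2 (lr_src a)).
    by rewrite -lpa_mulE lpa_mulA lpa_one_vert lpa_mulE; apply/lpa_piP/lr_src.
  + rewrite -[in LHS]((lpa_piP _ _).2 (lr_rngG a)).
    by rewrite -lpa_mulE lpa_mulA lpa_one_vert lpa_mulE; apply/lpa_piP/lr_rngG.
- by rewrite v0 lpa_mulx0.
- by rewrite -lpa_oppE lpa_mulxN IH.
- by rewrite -lpa_addE lpa_mulDr IHt IHu.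
- by rewrite -lpa_mulE lpa_mulA IHt.
- by rewrite -lpa_scaleE -lpa_scale_mulr IH.
Qed.

Lemma lpa_mulx1 : right_id lpa_one lpa_mul.
Proof.
move=> x; have [t ->] := lpa_pi_surj x.
elim: t => [g||t IH|t IHt u IHu|t IHt u IHu|k t IH].
- case: g => [v|a|a]; first exact: lpa_vert_one.
  + rewrite -[in LHS]((lpa_piP _ _).2 (lr_rng a)).
    by rewrite -lpa_mulE -lpa_mulA lpa_vert_one lpa_mulE; apply/lpa_piP/lr_rng.
  + rewrite -[in LHS]((lpa_piP _ _).2 (lr_srcG a)).
    by rewrite -lpa_mulE -lpa_mulA lpa_vert_one lpa_mulE; apply/lpa_piP/lr_srcG.
- by rewrite v0 lpa_mul0.
- by rewrite -lpa_oppE lpa_mulN IH.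
- by rewrite -lpa_addE lpa_mulDl IHt IHu.
- by rewrite -lpa_mulE -lpa_mulA IHu.
- by rewrite -lpa_scaleE -lpa_scale_mull IH.
Qed.

(* A mere [pzRingType]: the algebra of the empty graph is zero. *)
HB.instance Definition _ := GRing.Zmodule_isPzRing.Build leavitt
  lpa_mulA lpa_mul1 lpa_mulx1 lpa_mulDl lpa_mulDr.

Lemma lpa_scaleAl (k : K) (x y : leavitt) : k *: (x * y) = (k *: x) * y.
Proof. exact: lpa_scale_mull. Qed.
Lemma lpa_scaleAr (k : K) (x y : leavitt) : k *: (x * y) = x * (k *: y).
Proof. exact: lpa_scale_mulr. Qed.

(* The span of the monomials of degree i; it is inductively defined, since the
   degree of a product is the sum of the degrees. *)
Inductive lpa_comp : int -> leavitt -> Prop :=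
  | lc_gen g : lpa_comp (lpa_deg g) (lpa_pi (LGen g))
  | lc_zero i : lpa_comp i 0
  | lc_add i x y : lpa_comp i x -> lpa_comp i y -> lpa_comp i (x + y)
  | lc_scale i k x : lpa_comp i x -> lpa_comp i (k *: x)
  | lc_mul i j x y : lpa_comp i x -> lpa_comp j y -> lpa_comp (i + j) (x * y).

Lemma lpa_compB i x y : lpa_comp i x -> lpa_comp i y -> lpa_comp i (x - y).
Proof. by move=> cx cy; rewrite -scaleN1r; apply: lc_add; last apply: lc_scale. Qed.

Lemma lpa_comp_sum i (I : Type) (r : seq I) (F : I -> leavitt) :
  (forall j, lpa_comp i (F j)) -> lpa_comp i (\sum_(j <- r) F j).
Proof. by move=> cF; elim/big_rec: _ => [|j x _]; [apply: lc_zero|apply: lc_add]. Qed.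

Lemma lpa_comp1 : lpa_comp 0 1.
Proof. by apply: lpa_comp_sum => v; apply: (lc_gen (LVert v)). Qed.

(* Linear independence of the components: a term acts on Z-indexed families,
   a generator of degree d shifting the index by d. *)
Fixpoint lpa_act (t : lpa_term) (f : int -> leavitt) (n : int) : leavitt :=
  match t with
  | LGen g => lpa_pi (LGen g) * f (n - lpa_deg g)
  | LZero => 0
  | LOpp t => - lpa_act t f n
  | LAdd t u => lpa_act t f n + lpa_act u f n
  | LMul t u => lpa_act t (lpa_act u f) n
  | LScale k t => k *: lpa_act t f n
  end.

Lemma lpa_act_ext t f f' : f =1 f' -> lpa_act t f =1 lpa_act t f'.
Proof.
elim: t f f' => [g||t IH|t IHt u IHu|t IHt u IHu|k t IH] f f' ff' n //=.
- by rewrite ff'.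
- by rewrite (IH f f').
- by rewrite (IHt f f') // (IHu f f').
- by apply: IHt => m; apply: IHu.
- by rewrite (IH f f').
Qed.

Lemma lpa_actD t f f' n :
  lpa_act t (fun m => f m + f' m) n = lpa_act t f n + lpa_act t f' n.
Proof.
elim: t f f' n => [g||t IH|t IHt u IHu|t IHt u IHu|k t IH] f f' n //=.
- by rewrite addr0.
- by rewrite IH opprD.
- by rewrite IHt IHu addrACA.
- by rewrite -IHt; apply: lpa_act_ext => m; rewrite IHu.
- by rewrite IH scalerDr.
Qed.

Lemma lpa_actZ t k f n : lpa_act t (fun m => k *: f m) n = k *: lpa_act t f n.
Proof.
elim: t f n => [g||t IH|t IHt u IHu|t IHt u IHu|l t IH] f n //=.
- by rewrite lpa_scaleAr.
- by rewrite scaler0.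
- by rewrite IH scalerN.
- by rewrite IHt IHu scalerDr.
- by rewrite -IHt; apply: lpa_act_ext => m; rewrite IHu.
- by rewrite IH !scalerA mulrC.
Qed.

Lemma lpa_pi0 t : lpa_rel t LZero -> lpa_pi t = 0.
Proof. by move/lpa_piP => ->. Qed.

Lemma lpa_pi_mul t u w : lpa_rel (LMul t u) w -> lpa_pi t * lpa_pi u = lpa_pi w.
Proof. by move=> tu; rewrite -[LHS]/(lpa_mul _ _) lpa_mulE; apply/lpa_piP. Qed.

Lemma lpa_act_rel t u : lpa_rel t u -> forall f, lpa_act t f =1 lpa_act u f.
Proof.
elim=> {t u} /=.
- by [].
- by move=> t u _ IH f n; rewrite IH.
- by move=> t u w _ IHt _ IHu f n; rewrite IHt IHu.
- by move=> t t' _ IH f n; rewrite IH.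
- by move=> t t' u u' _ IHt _ IHu f n; rewrite IHt IHu.
- move=> t t' u u' _ IHt _ IHu f n; rewrite IHt.
  by apply: lpa_act_ext => m; rewrite IHu.
- by move=> k t t' _ IH f n; rewrite IH.
- by move=> t u w f n; rewrite addrA.
- by move=> t u f n; rewrite addrC.
- by move=> t f n; rewrite add0r.
- by move=> t f n; rewrite addNr.
- by [].
- by [].
- by move=> t u w f n; rewrite -lpa_actD; apply: lpa_act_ext.
- by move=> a b t f n; rewrite scalerA.
- by move=> t f n; rewrite scale1r.
- by move=> a t u f n; rewrite scalerDr.
- by move=> a b t f n; rewrite scalerDl.
- by [].
- by move=> a t u f n; rewrite -lpa_actZ.
- move=> v w f n; rewrite !subr0 mulrA (lpa_pi_mul (lr_vert v w)).
  by case: eqP => [->|_] /=; rewrite ?subr0 // v0 mul0r.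
- by move=> a f n; rewrite subr0 mulrA (lpa_pi_mul (lr_src a)).
- by move=> a f n; rewrite subr0 mulrA (lpa_pi_mul (lr_rng a)).
- by move=> a f n; rewrite subr0 mulrA (lpa_pi_mul (lr_rngG a)).
- by move=> a f n; rewrite subr0 mulrA (lpa_pi_mul (lr_srcG a)).
- move=> a b f n; rewrite opprK addrK mulrA (lpa_pi_mul (lr_CK1 a b)).
  by case: eqP => [->|_] /=; rewrite ?subr0 // v0 mul0r.
- move=> v va f n; rewrite subr0 -((lpa_piP _ _).2 (lr_CK2 va)) /lpa_CK2_term.
  elim: [seq _ <- _ | _] => [|a r IH] /=; first by rewrite v0 mul0r.
  rewrite IH -lpa_addE [RHS]mulrDl; congr (_ + _).
  by rewrite -lpa_mulE opprK subrK mulrA.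
Qed.

Definition lpa_delta (n : int) : leavitt := if n == 0 then 1 else 0.
Definition lpa_proj (x : leavitt) := lpa_act (repr x) lpa_delta.

Lemma lpa_projE t n : lpa_proj (lpa_pi t) n = lpa_act t lpa_delta n.
Proof. exact: lpa_act_rel (lpa_reprP t) _ _. Qed.

Lemma lpa_projD x y n : lpa_proj (x + y) n = lpa_proj x n + lpa_proj y n.
Proof.
have [t ->] := lpa_pi_surj x; have [u ->] := lpa_pi_surj y.
by rewrite -[_ + _]/(lpa_add _ _) lpa_addE !lpa_projE.
Qed.

Lemma lpa_proj0 n : lpa_proj 0 n = 0.
Proof. by rewrite -v0 lpa_projE. Qed.

Lemma lpa_act_comp i x : lpa_comp i x ->
  forall t, x = lpa_pi t -> forall f n, lpa_act t f n = x * f (n - i).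
Proof.
elim=> {i x}.
- by move=> g t /lpa_piP /lr_sym gt f n; rewrite (lpa_act_rel gt).
- by move=> i t /lpa_piP /lr_sym z f n; rewrite (lpa_act_rel z) mul0r.
- move=> i x y _; have [t ->] := lpa_pi_surj x => IHx.
  move=> _; have [u ->] := lpa_pi_surj y => IHy w.
  rewrite -[_ + _]/(lpa_add _ _) {1}lpa_addE => /lpa_piP /lr_sym r f n.
  by rewrite (lpa_act_rel r) /= (IHx t) // (IHy u) // -mulrDl.
- move=> i k x _; have [t ->] := lpa_pi_surj x => IHx w.
  rewrite -[_ *: _]/(lpa_scale _ _) {1}lpa_scaleE => /lpa_piP /lr_sym r f n.
  by rewrite (lpa_act_rel r) /= (IHx t) // lpa_scaleAl.
- move=> i j x y _; have [t ->] := lpa_pi_surj x => IHx.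
  move=> _; have [u ->] := lpa_pi_surj y => IHy w.
  rewrite -[_ * _]/(lpa_mul _ _) {1}lpa_mulE => /lpa_piP /lr_sym r f n.
  rewrite (lpa_act_rel r) /= (IHx t) // (IHy u) // mulrA.
  by rewrite opprD addrA.
Qed.

Lemma lpa_proj_comp i x n : lpa_comp i x ->
  lpa_proj x n = if n == i then x else 0.
Proof.
move=> cx; rewrite /lpa_proj (lpa_act_comp cx) /lpa_delta; last first.
  by rewrite /lpa_pi reprK.
by rewrite subr_eq0; case: eqP; rewrite ?mulr1 ?mulr0.
Qed.

Lemma lpa_span x : exists2 s : seq (int * leavitt),
  (forall p, p \in s -> lpa_comp p.1 p.2) & x = \sum_(p <- s) p.2.
Proof.
have [t ->] := lpa_pi_surj x.
elim: t => [g||t [s cs IHt]|t [s cs IHt] u [r cr IHu]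
          |t [s cs IHt] u [r cr IHu]|k t [s cs IHt]].
- exists [:: (lpa_deg g, lpa_pi (LGen g))]; last by rewrite big_seq1.
  by move=> p; rewrite inE => /eqP ->; apply: lc_gen.
- by exists [::]; rewrite ?big_nil.
- exists [seq (p.1, - p.2) | p <- s].
    move=> _ /mapP[p /cs cp ->] /=; rewrite -[- _]add0r.
    by apply: lpa_compB => //; apply: lc_zero.
  by rewrite big_map /= sumrN -IHt -lpa_oppE.
- exists (s ++ r); last by rewrite big_cat /= -IHt -IHu -lpa_addE.
  by move=> p; rewrite mem_cat => /orP[/cs|/cr].
- exists [seq (p.1 + q.1, p.2 * q.2) | p <- s, q <- r].
    by move=> _ /allpairsP[[p q] /= [/cs cp /cr cq ->]]; apply: lc_mul.
  transitivity ((\sum_(p <- s) p.2) * (\sum_(q <- r) q.2)).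
    by rewrite -IHt -IHu -lpa_mulE.
  rewrite big_allpairs_dep /= mulr_suml.
  by apply: eq_bigr => p _; rewrite mulr_sumr.
- exists [seq (p.1, k *: p.2) | p <- s].
    by move=> _ /mapP[p /cs cp ->] /=; apply: lc_scale.
  by rewrite big_map /= -scaler_sumr -IHt -lpa_scaleE.
Qed.

Lemma lpa_grading : internal_grading lpa_comp.
Proof.
split; [exact: lc_zero|exact: lpa_compB|exact: lpa_span|].
move=> s f us cf f0 i si.
have: lpa_proj (\sum_(j <- s) f j) i = 0 by rewrite f0 lpa_proj0.
rewrite (big_morph (lpa_proj^~ i) (fun x y => lpa_projD x y i) (lpa_proj0 i)).
rewrite (bigD1_seq i) //= (lpa_proj_comp i (cf i)) eqxx big1 ?addr0 // => j ji.
by rewrite (lpa_proj_comp i (cf j)) eq_sym (negPf ji).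
Qed.

Definition leavitt_gr : gradedRing :=
  GradedRing lpa_grading lpa_comp1 lc_mul.

End Leavitt.

Definition fin_generated (S : pzRingType) (M : lmodType S) : Prop :=
  exists (n : nat) (g : 'I_n -> M),
    forall x, exists c : 'I_n -> S, x = \sum_i c i *: g i.

Definition projective (S : pzRingType) (P : lmodType S) : Prop :=
  forall (M N : lmodType S) (g : {linear M -> N}) (f : {linear P -> N}),
    (forall y, exists x, g x = y) ->
    exists h : {linear P -> M}, forall x, g (h x) = f x.

(* Right R-modules are left modules over the converse ring: for [r : op_ring R],
   the element [r *: m] is the product m r. *)
Definition op_ring (R : pzRingType) : pzRingType := GRing.PzRing.clone R^c _.

Record grmod (R : gradedRing) := GrMod {
  gmod :> lmodType (op_ring R);
  gcomp : int -> gmod -> Prop;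
  gcomp_grading : internal_grading gcomp;
  gcompZ : forall i j (m : gmod) (r : R), gcomp i m -> gring_comp j r ->
    gcomp (i + j) ((r : op_ring R) *: m) }.

(* Projectivity is that of the underlying ungraded module, which for a graded
   module is equivalent to projectivity among graded modules. *)
Record grproj (R : gradedRing) := GrProj {
  gproj_mod :> grmod R;
  gproj_fg : fin_generated gproj_mod;
  gproj_proj : projective gproj_mod }.

Definition gr_iso (R : gradedRing) (P Q : grmod R) : Prop :=
  exists f : {linear P -> Q},
    bijective f /\ forall i x, gcomp i x <-> gcomp i (f x).

Definition linear_pack (S : pzRingType) (U V : lmodType S) (f : U -> V)
    (lf : linear f) : {linear U -> V} :=
  HB.pack_for {linear U -> V} f (GRing.isLinear.Build S U V _ f lf).

Section GrIso.
Variable R : gradedRing.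
Implicit Types P Q : grmod R.

Lemma gr_iso_refl P : gr_iso P P.
Proof. by exists idfun; split=> //; exists idfun. Qed.

Lemma can_linear P Q (f : {linear P -> Q}) g : cancel f g -> cancel g f ->
  exists h : {linear Q -> P}, h =1 g.
Proof.
move=> fg gf.
have lg : linear g by move=> a x y; rewrite -{1}[x]gf -{1}[y]gf -linearP fg.
by exists (linear_pack lg).
Qed.

Lemma gr_iso_sym P Q : gr_iso P Q -> gr_iso Q P.
Proof.
case=> f [[g fg gf] cf]; have [h hg] := can_linear fg gf.
exists h; split; first by exists f => x; rewrite hg.
by move=> i x; rewrite hg cf gf.
Qed.

Lemma gr_iso_trans P Q S : gr_iso P Q -> gr_iso Q S -> gr_iso P S.
Proof.
case=> f [bf cf] [g [bg cg]]; exists (g \o f); split; first exact: bij_comp.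
by move=> i x; rewrite cf cg.
Qed.

End GrIso.

(* The isomorphism class of a finitely generated graded module P is recorded as
   the set of the isomorphic copies of P whose carrier is a subset of the fixed
   type [seq R]; there are such copies, see [gr_copy_exists]. The classes thus
   form a small type, while P itself ranges over arbitrary modules. *)
Record gr_code (R : gradedRing) := GrCode {
  code_carrier : seq R -> Prop;
  code_add : seq R -> seq R -> seq R;
  code_scale : R -> seq R -> seq R;
  code_comp : int -> seq R -> Prop }.

Definition gr_copy (R : gradedRing) (P : grmod R) (c : gr_code R) : Prop :=
  exists f : P -> seq R,
    [/\ injective f,
        forall s, code_carrier c s <-> exists x, f x = s,
        forall x y, f (x + y) = code_add c (f x) (f y),
        forall (r : R) x, f ((r : op_ring R) *: x) = code_scale c r (f x)
      & forall i x, gcomp i x <-> code_comp c i (f x)].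

Section IsoClasses.
Variable R : gradedRing.
Implicit Types P Q : grproj R.

Lemma gr_copy_exists P : exists c, gr_copy P c.
Proof.
have [n [g gP]] := gproj_fg P.
pose ev (s : seq R) : P := \sum_(i < n) (nth 0 s i : op_ring R) *: g i.
have evP x : exists s, x == ev s.
  have [c ->] := gP x; exists [seq c i | i <- enum 'I_n].
  apply/eqP/eq_bigr => i _; congr (_ *: _).
  by rewrite (nth_map i) ?size_enum_ord // nth_ord_enum.
pose f x : seq R := xchoose (evP x).
have fK x : ev (f x) = x by apply/esym/eqP/(xchooseP (evP x)).
exists (GrCode (fun s => exists x, f x = s) (fun s t => f (ev s + ev t))
  (fun r s => f ((r : op_ring R) *: ev s)) (fun i s => gcomp i (ev s))), f.
by split=> [|//|x y|r x|i x] /=; rewrite ?fK //; exact: can_inj fK.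
Qed.

Lemma gr_copy_iso P Q c : gr_iso P Q -> gr_copy P c -> gr_copy Q c.
Proof.
move=> /gr_iso_sym[h [[k hk kh] ch]] [f [fi fc fD fZ fC]]; exists (f \o h).
split=> [|s|x y|r x|i x] /=.
- exact: inj_comp fi (can_inj hk).
- rewrite fc; split=> -[x <-]; last by exists (h x).
  by exists (k x); rewrite kh.
- by rewrite raddfD fD.
- by rewrite linearZ fZ.
- by rewrite ch fC.
Qed.

Lemma iso_gr_copy P Q c : gr_copy P c -> gr_copy Q c -> gr_iso P Q.
Proof.
move=> [f [fi fc fD fZ fC]] [g [gi gc gD gZ gC]].
have [h hE] : {h : P -> Q & forall x, g (h x) = f x}.
  by apply: (@boolp.choice P Q (fun x y => g y = f x)) => x; apply/gc/fc; exists x.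
have [k kE] : {k : Q -> P & forall x, f (k x) = g x}.
  by apply: (@boolp.choice Q P (fun x y => f y = g x)) => x; apply/fc/gc; exists x.
have lh : linear h.
  by move=> a x y; apply: gi; rewrite hE fD fZ gD gZ !hE.
exists (linear_pack lh); split=> [|i x] /=.
  by exists k => x; [apply: fi; rewrite kE hE|apply: gi; rewrite hE kE].
by rewrite fC gC hE.
Qed.

Lemma gr_copyP P Q : gr_copy P = gr_copy Q <-> gr_iso P Q.
Proof.
split=> [e|PQ].
  by have [c cP] := gr_copy_exists P; apply: (iso_gr_copy cP); rewrite -e.
apply/funext => c; apply/propext; split; apply: gr_copy_iso => //.
exact: gr_iso_sym.
Qed.

Definition Vgr : Type :=
  {X : gr_code R -> Prop | exists P : grproj R, X = gr_copy P}.

HB.instance Definition _ := gen_eqMixin Vgr.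
HB.instance Definition _ := gen_choiceMixin Vgr.

Definition vclass P : Vgr := exist _ (gr_copy P) (ex_intro _ P erefl).

Lemma Vgr_inj (v w : Vgr) : proj1_sig v = proj1_sig w -> v = w.
Proof. by case: v w => [X pX] [Y pY] /= e; apply: eq_exist. Qed.

Lemma vclassP P Q : vclass P = vclass Q <-> gr_iso P Q.
Proof.
by rewrite -gr_copyP; split=> [[]|e] //; apply: Vgr_inj.
Qed.

Definition vrep (v : Vgr) : grproj R := projT1 (cid (proj2_sig v)).

Lemma vrepK v : vclass (vrep v) = v.
Proof. by apply: Vgr_inj; rewrite /= /vrep; case: cid. Qed.

Lemma vrep_iso P : gr_iso (vrep (vclass P)) P.
Proof. by apply/vclassP; rewrite vrepK. Qed.

End IsoClasses.

Section Constructions.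
Variable R : gradedRing.

Section DirectSum.
Variables P Q : grmod R.

Definition dsum_comp (i : int) (x : P * Q) : Prop :=
  gcomp i x.1 /\ gcomp i x.2.

Lemma dsum_grading : internal_grading dsum_comp.
Proof.
have [P0 PB Ps Pf] := gcomp_grading P; have [Q0 QB Qs Qf] := gcomp_grading Q.
split=> [i|i x y [? ?] [? ?]|[x y]|s f us cf f0 i si].
- by split.
- by split; [apply: PB|apply: QB].
- have [s cs ->] := Ps x; have [r cr ->] := Qs y.
  exists ([seq (p.1, (p.2, 0)) | p <- s] ++ [seq (p.1, (0, p.2)) | p <- r]).
    move=> p; rewrite mem_cat => /orP[] /mapP[q qs ->]; split=> //=.
    + exact: cs.
    + exact: cr.
  rewrite big_cat !big_map /=.
  have e1 (t : seq (int * P)) :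
      \sum_(p <- t) ((p.2, 0) : P * Q) = (\sum_(p <- t) p.2, 0).
    by elim: t => [|p t IH]; rewrite ?big_nil // !big_cons IH; congr (_, _);
      rewrite /= addr0.
  have e2 (t : seq (int * Q)) :
      \sum_(p <- t) ((0, p.2) : P * Q) = (0, \sum_(p <- t) p.2).
    by elim: t => [|p t IH]; rewrite ?big_nil // !big_cons IH; congr (_, _);
      rewrite /= addr0.
  by rewrite e1 e2; congr (_, _); rewrite /= ?addr0 ?add0r.
- have f1 : \sum_(i <- s) (f i).1 = 0 by rewrite -(raddf_sum fst) f0.
  have f2 : \sum_(i <- s) (f i).2 = 0 by rewrite -(raddf_sum snd) f0.
  rewrite [f i]surjective_pairing (Pf s _ us _ f1 i si); last by move=> j; case: (cf j).
  by rewrite (Qf s _ us _ f2 i si) // => j; case: (cf j).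
Qed.

Lemma dsum_compZ i j (m : P * Q) (r : R) : dsum_comp i m -> gring_comp j r ->
  dsum_comp (i + j) ((r : op_ring R) *: m).
Proof. by move=> [? ?] ?; split; apply: gcompZ. Qed.

Definition dsum_mod : grmod R := GrMod dsum_grading dsum_compZ.

End DirectSum.

Lemma dsum_fg (P Q : grproj R) : fin_generated (dsum_mod P Q).
Proof.
have [n [g gP]] := gproj_fg P; have [m [h hP]] := gproj_fg Q.
exists (n + m)%N,
  (fun i => match split i with inl j => (g j, 0) | inr k => (0, h k) end).
move=> [x y]; have [c ->] := gP x; have [d ->] := hP y.
exists (fun i => match split i with inl j => c j | inr k => d k end).
rewrite big_split_ord /=.
under [X in _ = X + _]eq_bigr => i _ do
  rewrite -[lshift m i]/(unsplit (inl i)) unsplitK.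
under [X in _ = _ + X]eq_bigr => i _ do
  rewrite -[rshift n i]/(unsplit (inr i)) unsplitK.
rewrite [RHS]surjective_pairing /= !(raddf_sum fst) !(raddf_sum snd) /=.
congr (_, _).
  by rewrite [X in _ = _ + X]big1 ?addr0 // => i _; apply: scaler0.
by rewrite [X in _ = X + _]big1 ?add0r // => i _; apply: scaler0.
Qed.

Lemma dsum_proj (P Q : grproj R) : projective (dsum_mod P Q).
Proof.
move=> M N g f gs.
have l1 : linear (fun x : P => f (x, 0)).
  move=> a x y; rewrite -linearP; congr (f (_, _)).
  by rewrite /= scaler0 addr0.
have l2 : linear (fun x : Q => f (0, x)).
  move=> a x y; rewrite -linearP; congr (f (_, _)).
  by rewrite /= scaler0 addr0.
have [h1 h1P] := gproj_proj (linear_pack l1) gs.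
have [h2 h2P] := gproj_proj (linear_pack l2) gs.
have lh : linear (fun x : P * Q => h1 x.1 + h2 x.2).
  by move=> a x y; rewrite /= !linearP scalerDr addrACA.
exists (linear_pack lh) => -[x y] /=.
transitivity (f (x, 0) + f (0, y)).
  transitivity (g (h1 x) + g (h2 y)); first exact: raddfD.
  by congr (_ + _); [apply: h1P|apply: h2P].
transitivity (f ((x, 0) + (0, y))); first by symmetry; exact: raddfD.
by congr (f (_, _)); rewrite /= ?addr0 ?add0r.
Qed.

Definition dsum (P Q : grproj R) : grproj R :=
  GrProj (dsum_fg P Q) (@dsum_proj P Q).

Let zmod : lmodType (op_ring R) := 'rV[op_ring R]_0.

Lemma zmod_grading : internal_grading (fun (_ : int) (_ : zmod) => True).
Proof.
split=> // [x|s f _ _ _ i _]; last exact: thinmx0.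
by exists [::] => //; rewrite big_nil; apply: thinmx0.
Qed.

Definition gzero_mod : grmod R :=
  @GrMod R zmod _ zmod_grading (fun _ _ _ _ _ _ => I).

Lemma gzero_fg : fin_generated gzero_mod.
Proof.
exists 0%N, (fun=> 0) => x; exists (fun=> 0); rewrite big_ord0.
exact: thinmx0.
Qed.

Lemma gzero_proj : projective gzero_mod.
Proof.
move=> M N g f _; exists \0%R => x.
by rewrite (thinmx0 x) !raddf0.
Qed.

Definition gzero : grproj R := GrProj gzero_fg gzero_proj.

Section Shift.
Variables (j : int) (P : grmod R).

Definition shift_comp (i : int) (x : P) : Prop := gcomp (i + j) x.

Lemma shift_grading : internal_grading shift_comp.
Proof.
have [P0 PB Ps Pf] := gcomp_grading P.
split=> [i|i x y|x|s f us cf f0 i si].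
- exact: P0.
- exact: PB.
- have [s cs ->] := Ps x; exists [seq (p.1 - j, p.2) | p <- s].
    by move=> _ /mapP[p /cs cp ->]; rewrite /shift_comp /= subrK.
  by rewrite big_map.
- have := Pf [seq k + j | k <- s] (fun k => f (k - j)) _ _ _ (i + j).
  rewrite addrK; apply.
  + by rewrite map_inj_uniq //; apply: addIr.
  + by move=> k; have := cf (k - j); rewrite /shift_comp subrK.
  + by rewrite big_map -[RHS]f0; apply: eq_bigr => k _; rewrite addrK.
  + exact: map_f.
Qed.

Lemma shift_compZ i k (m : P) (r : R) : shift_comp i m -> gring_comp k r ->
  shift_comp (i + k) ((r : op_ring R) *: m).
Proof. by move=> cm cr; rewrite /shift_comp addrAC; apply: gcompZ. Qed.

Definition shift_mod : grmod R := GrMod shift_grading shift_compZ.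

End Shift.

Definition gshift (j : int) (P : grproj R) : grproj R :=
  @GrProj R (shift_mod j P) (gproj_fg P) (@gproj_proj R P).

Lemma dsum_iso (P P' Q Q' : grproj R) :
  gr_iso P P' -> gr_iso Q Q' -> gr_iso (dsum P Q) (dsum P' Q').
Proof.
move=> [f [[f' fK f'K] fC]] [g [[g' gK g'K] gC]].
have lh : linear (fun x : P * Q => (f x.1, g x.2)).
  by move=> a x y; rewrite /= !linearP.
exists (linear_pack lh); split.
  by exists (fun x => (f' x.1, g' x.2)) => -[x y] /=; rewrite ?fK ?gK ?f'K ?g'K.
by move=> i [x y] /=; split=> -[/= a b]; split; apply/fC || apply/gC.
Qed.

Lemma dsumC (P Q : grproj R) : gr_iso (dsum P Q) (dsum Q P).
Proof.
have lh : linear (fun x : P * Q => (x.2, x.1)) by [].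
exists (linear_pack lh); split.
  by exists (fun x => (x.2, x.1)) => -[x y].
by move=> i [x y]; split=> -[].
Qed.

Lemma dsumA (P Q S : grproj R) :
  gr_iso (dsum P (dsum Q S)) (dsum (dsum P Q) S).
Proof.
have lh : linear (fun x : P * (Q * S) => ((x.1, x.2.1), x.2.2)) by [].
exists (linear_pack lh); split.
  by exists (fun x => (x.1.1, (x.1.2, x.2))) => [[x [y z]]|[[x y] z]].
by move=> i [x [y z]]; split=> [[? [? ?]]|[[? ?] ?]].
Qed.

Lemma dsum0 (P : grproj R) : gr_iso (dsum gzero P) P.
Proof.
exists snd; split; last by move=> i [x y]; split=> [[]|].
exists (fun y => (0, y)) => // -[x y] /=; congr (_, _).
by apply/esym/thinmx0.
Qed.

Lemma gshift_iso j (P Q : grproj R) :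
  gr_iso P Q -> gr_iso (gshift j P) (gshift j Q).
Proof. by case=> f [bf cf]; exists f; split=> // i x; apply: cf. Qed.

Lemma gshift_dsum j (P Q : grproj R) :
  gr_iso (gshift j (dsum P Q)) (dsum (gshift j P) (gshift j Q)).
Proof. exact: gr_iso_refl. Qed.

Lemma gshift0 (P : grproj R) : gr_iso (gshift 0 P) P.
Proof.
exists idfun; split; first by exists idfun.
by move=> i x; rewrite /= /shift_comp addr0.
Qed.

Lemma gshiftD j k (P : grproj R) :
  gr_iso (gshift (j + k) P) (gshift j (gshift k P)).
Proof.
exists idfun; split; first by exists idfun.
by move=> i x; rewrite /= /shift_comp /= /shift_comp addrA.
Qed.

Lemma gshift_gzero j : gr_iso (gshift j gzero) gzero.
Proof. exact: gr_iso_refl. Qed.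

Implicit Types v w : Vgr R.

Definition vadd v w : Vgr R := vclass (dsum (vrep v) (vrep w)).
Definition vshift (j : int) v : Vgr R := vclass (gshift j (vrep v)).

Lemma vclass_dsum (P Q : grproj R) : vadd (vclass P) (vclass Q) = vclass (dsum P Q).
Proof. by apply/vclassP/dsum_iso; apply: vrep_iso. Qed.

Lemma vclass_gshift j (P : grproj R) : vshift j (vclass P) = vclass (gshift j P).
Proof. by apply/vclassP/gshift_iso/vrep_iso. Qed.

Lemma vaddA : associative vadd.
Proof.
move=> u v w; rewrite -(vrepK u) -(vrepK v) -(vrepK w) !vclass_dsum.
exact/vclassP/dsumA.
Qed.

Lemma vaddC : commutative vadd.
Proof. by move=> u v; apply/vclassP/dsumC. Qed.

Lemma vadd0 : left_id (vclass gzero) vadd.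
Proof. by move=> v; rewrite -(vrepK v) vclass_dsum; apply/vclassP/dsum0. Qed.

HB.instance Definition _ := GRing.isNmodule.Build (Vgr R) vaddA vaddC vadd0.

Lemma vshiftD j v w : vshift j (v + w) = vshift j v + vshift j w.
Proof.
rewrite -(vrepK v) -(vrepK w) -![_ + _]/(vadd _ _).
by rewrite !(vclass_dsum, vclass_gshift); apply/vclassP/gshift_dsum.
Qed.

Lemma vshift_0 v : vshift 0 v = v.
Proof. by rewrite -{2}(vrepK v); apply/vclassP/gshift0. Qed.

Lemma vshift_add j k v : vshift (j + k) v = vshift j (vshift k v).
Proof. by rewrite -(vrepK v) !vclass_gshift; apply/vclassP/gshiftD. Qed.

End Constructions.

Section Completion.
Variable V : nmodType.

Definition gc_rel (a b : V * V) : bool :=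
  `[< exists e, a.1 + b.2 + e = b.1 + a.2 + e >].

Lemma gc_rel_refl : reflexive gc_rel.
Proof. by move=> a; apply/asboolP; exists 0. Qed.

Lemma gc_rel_sym : symmetric gc_rel.
Proof. by move=> a b; apply/asboolP/asboolP => -[e ae]; exists e. Qed.

Lemma gc_rel_trans : transitive gc_rel.
Proof.
move=> b a c /asboolP[e ab] /asboolP[f bc]; apply/asboolP.
exists (b.1 + b.2 + e + f).
rewrite [LHS](AC (2*4) ((1*4*5)*(3*2*6))) [RHS](AC (2*4) ((3*2*5)*(1*4*6))) /=.
by rewrite ab bc.
Qed.

Canonical gc_equiv := EquivRel gc_rel gc_rel_refl gc_rel_sym gc_rel_trans.

Definition gcompletion : Type := {eq_quot gc_equiv}.
HB.instance Definition _ := Choice.on gcompletion.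
HB.instance Definition _ := EqQuotient.on gcompletion.

Definition gc_pi (a : V * V) : gcompletion := \pi_gcompletion a.

Lemma gc_piP a b :
  gc_pi a = gc_pi b <-> exists e, a.1 + b.2 + e = b.1 + a.2 + e.
Proof. by split=> [/eqmodP/asboolP|?] //; apply/eqmodP/asboolP. Qed.

Lemma gc_pi_surj x : exists a, x = gc_pi a.
Proof. by exists (repr x); rewrite /gc_pi reprK. Qed.

Definition gc_add (x y : gcompletion) : gcompletion :=
  gc_pi ((repr x).1 + (repr y).1, (repr x).2 + (repr y).2).
Definition gc_opp (x : gcompletion) : gcompletion :=
  gc_pi ((repr x).2, (repr x).1).

Lemma gc_reprP a : exists e,
  (repr (gc_pi a)).1 + a.2 + e = a.1 + (repr (gc_pi a)).2 + e.
Proof. by apply/gc_piP; rewrite /gc_pi reprK. Qed.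

Let shuffle (a b c d e f : V) :
  a + b + (c + d) + (e + f) = (a + c + e) + (b + d + f).
Proof. by rewrite (addrACA a) addrACA. Qed.

Lemma gc_addE a b : gc_add (gc_pi a) (gc_pi b) = gc_pi (a.1 + b.1, a.2 + b.2).
Proof.
apply/gc_piP; have [e ae] := gc_reprP a; have [f bf] := gc_reprP b.
by exists (e + f); rewrite /= [LHS]shuffle [RHS]shuffle ae bf.
Qed.

Lemma gc_oppE a : gc_opp (gc_pi a) = gc_pi (a.2, a.1).
Proof.
apply/gc_piP; have [e ae] := gc_reprP a; exists e => /=.
by rewrite [_ + a.1]addrC -ae [a.2 + _]addrC.
Qed.

Lemma gc_addA : associative gc_add.
Proof.
move=> x y z; have [a ->] := gc_pi_surj x; have [b ->] := gc_pi_surj y.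
by have [c ->] := gc_pi_surj z; rewrite !gc_addE /= !addrA.
Qed.

Lemma gc_addC : commutative gc_add.
Proof.
move=> x y; have [a ->] := gc_pi_surj x; have [b ->] := gc_pi_surj y.
by rewrite !gc_addE /= [a.1 + _]addrC [a.2 + _]addrC.
Qed.

Lemma gc_add0 : left_id (gc_pi (0, 0)) gc_add.
Proof. by move=> x; have [[a b] ->] := gc_pi_surj x; rewrite gc_addE /= !add0r. Qed.

Lemma gc_addN : left_inverse (gc_pi (0, 0)) gc_opp gc_add.
Proof.
move=> x; have [[a b] ->] := gc_pi_surj x; rewrite gc_oppE gc_addE /=.
by apply/gc_piP; exists 0 => /=; rewrite !addr0 add0r addrC.
Qed.

HB.instance Definition _ :=
  GRing.isZmodule.Build gcompletion gc_addA gc_addC gc_add0 gc_addN.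

Definition gc_class (v : V) : gcompletion := gc_pi (v, 0).

Lemma gc_classD v w : gc_class (v + w) = gc_class v + gc_class w.
Proof. by rewrite -[RHS]/(gc_add _ _) gc_addE /= addr0. Qed.

Lemma gc_class_surj x : exists v w, x = gc_class v - gc_class w.
Proof.
have [[v w] ->] := gc_pi_surj x; exists v, w.
by rewrite -[RHS]/(gc_add _ (gc_opp _)) gc_oppE gc_addE /= addr0 add0r.
Qed.

Lemma gc_classP v w : gc_class v = gc_class w <-> exists e, v + e = w + e.
Proof. by rewrite gc_piP /= !addr0. Qed.

Section Map.
Variable f : V -> V.
Hypothesis fD : {morph f : v w / v + w}.

Definition gc_map (x : gcompletion) : gcompletion :=
  gc_class (f (repr x).1) - gc_class (f (repr x).2).

Lemma gc_mapE v w : gc_map (gc_class v - gc_class w) = gc_class (f v) - gc_class (f w).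
Proof.
rewrite /gc_map; set x := gc_class v - gc_class w.
have: x = gc_class (repr x).1 - gc_class (repr x).2.
  rewrite -[RHS]/(gc_add _ (gc_opp _)) gc_oppE gc_addE /= addr0 add0r.
  by rewrite -surjective_pairing /gc_pi reprK.
move/eqP; rewrite {1}/x subr_eq addrAC eq_sym subr_eq -!gc_classD => /eqP/gc_classP.
move=> [e ve]; apply/eqP; rewrite subr_eq addrAC eq_sym subr_eq -!gc_classD.
by apply/eqP/gc_classP; exists (f e); rewrite -!fD ve.
Qed.

Lemma gc_map_class v : gc_map (gc_class v) = gc_class (f v).
Proof.
have f0 : gc_class (f 0) = 0.
  by apply: (addrI (gc_class (f 0))); rewrite -gc_classD -fD !addr0.
by rewrite -[gc_class v]subr0 -[X in _ - X]/(gc_class 0) gc_mapE f0 subr0.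
Qed.

Lemma gc_mapD : {morph gc_map : x y / x + y}.
Proof.
move=> x y; have [v [w ->]] := gc_class_surj x; have [v' [w' ->]] := gc_class_surj y.
rewrite addrACA -opprD -!gc_classD !gc_mapE !fD !gc_classD opprD.
by rewrite addrACA.
Qed.

End Map.
End Completion.

Local Notation "x %:F" := (FracField.tofrac x) : ring_scope.

(* Z[x, x^-1], as the ring of the fractions p / x^n with p in Z[x]. *)
Definition laurent_pred : {pred {fraction {poly int}}} := fun q =>
  `[< exists (p : {poly int}) (n : nat), q = p%:F / ('X^n)%:F >].

Lemma tofracX_neq0 n : ('X^n : {poly int})%:F != 0.
Proof. by rewrite tofrac_eq0 -size_poly_eq0 size_polyXn. Qed.

Lemma laurent_subring : subring_closed laurent_pred.
Proof.
split.
- by apply/asboolP; exists 1, 0%N; rewrite expr0 tofrac1 divr1.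
- move=> _ _ /asboolP[p [n ->]] /asboolP[q [m ->]]; apply/asboolP.
  exists (p * 'X^m - q * 'X^n), (n + m)%N.
  rewrite exprD tofracB !tofracM mulrBl; congr (_ - _).
    by rewrite -mulf_div divff ?tofracX_neq0 // mulr1.
  by rewrite [_ * 'X^m%:F]mulrC -mulf_div divff ?tofracX_neq0 // mulr1.
- move=> _ _ /asboolP[p [n ->]] /asboolP[q [m ->]]; apply/asboolP.
  by exists (p * q), (n + m)%N; rewrite exprD !tofracM mulf_div.
Qed.

HB.instance Definition _ :=
  GRing.isSubringClosed.Build {fraction {poly int}} laurent_pred laurent_subring.

Record laurent := Laurent {
  laurent_val :> {fraction {poly int}};
  laurent_valP : laurent_val \in laurent_pred }.

HB.instance Definition _ := [isSub for laurent_val].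
HB.instance Definition _ := [Choice of laurent by <:].
HB.instance Definition _ := [SubChoice_isSubComNzRing of laurent by <:].

Section LaurentAction.
Variables (V : zmodType) (T : int -> V -> V).
Hypotheses (T0 : T 0 =1 id) (TA : forall (i j : int) v, T (i + j) v = T i (T j v)).
Hypothesis TD : forall i, {morph T i : v w / v + w}.

Implicit Types (p : {poly int}) (v w : V) (i j : int).

Definition peval (p : {poly int}) (v : V) : V :=
  \sum_(i < size p) T i v *~ p`_i.

Lemma pevalE n p v : (size p <= n)%N -> peval p v = \sum_(i < n) T i v *~ p`_i.
Proof.
move=> pn; rewrite /peval (big_ord_widen n (fun i : nat => T i v *~ p`_i)) //.
rewrite big_mkcond; apply: eq_bigr => i _; case: ltnP => // ip.
by rewrite nth_default // mulr0z.
Qed.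

Lemma opT0 i : T i 0 = 0.
Proof. by apply: (addrI (T i 0)); rewrite -TD !addr0. Qed.
Lemma opTN i v : T i (- v) = - T i v.
Proof. by apply: (addrI (T i v)); rewrite -TD !subrr opT0. Qed.
Lemma opTMn i v n : T i (v *+ n) = T i v *+ n.
Proof. by elim: n => [|n IH]; rewrite ?mulr0n ?opT0 // !mulrS TD IH. Qed.
Lemma opTMz i v (z : int) : T i (v *~ z) = T i v *~ z.
Proof. by case: z => n; rewrite ?NegzE ?mulrNz -?pmulrn ?opTN opTMn. Qed.
Lemma opT_sum i (I : Type) (r : seq I) (F : I -> V) :
  T i (\sum_(j <- r) F j) = \sum_(j <- r) T i (F j).
Proof. by rewrite (big_morph (T i) (TD i) (opT0 i)). Qed.

Lemma pevalDl p (q : {poly int}) v : peval (p + q) v = peval p v + peval q v.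
Proof.
pose n := maxn (size p) (size q).
rewrite !(@pevalE n) ?leq_maxl ?leq_maxr ?(leq_trans (size_polyD _ _)) //.
by rewrite -big_split; apply: eq_bigr => i _; rewrite coefD mulrzDr.
Qed.

Lemma pevalDr p v w : peval p (v + w) = peval p v + peval p w.
Proof. by rewrite -big_split; apply: eq_bigr => i _; rewrite TD mulrzDl. Qed.

Lemma opT_peval j p v : T j (peval p v) = peval p (T j v).
Proof. by rewrite opT_sum; apply: eq_bigr => i _; rewrite opTMz -!TA addrC. Qed.

Lemma pevalMX p v : peval (p * 'X) v = T 1 (peval p v).
Proof.
rewrite (@pevalE (size p).+1); last first.
  have [->|p0] := eqVneq p 0; first by rewrite mul0r size_poly0.
  by rewrite size_mulX.
rewrite big_ord_recl coefMX /= mulr0z add0r opT_sum.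
by apply: eq_bigr => i _; rewrite coefMX /= opTMz -TA.
Qed.

Lemma pevalMXn p n v : peval (p * 'X^n) v = T n (peval p v).
Proof.
elim: n => [|n IH]; first by rewrite expr0 mulr1 T0.
by rewrite exprSr mulrA pevalMX IH -TA -PoszD.
Qed.

Lemma pevalMC c p v : peval (c%:P * p) v = peval p v *~ c.
Proof.
rewrite (@pevalE (size p) (c%:P * p)) ?mul_polyC ?size_scale_leq // /peval mulrz_suml.
by apply: eq_bigr => i _; rewrite ?coefZ ?coefCM mulrC mulrzA.
Qed.

Lemma peval0 v : peval 0 v = 0.
Proof. by rewrite /peval size_poly0 big_ord0. Qed.
Lemma peval1 v : peval 1 v = v.
Proof. by rewrite /peval size_poly1 big_ord1 coef1 mulr1z T0. Qed.

Lemma pevalM p (q : {poly int}) v : peval (p * q) v = peval p (peval q v).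
Proof.
elim/poly_ind: p => [|p c IH]; first by rewrite mul0r !peval0.
rewrite mulrDl mulrAC !pevalDl !pevalMX IH; congr (_ + _).
by rewrite -[c%:P in RHS]mulr1 !pevalMC peval1.
Qed.

Definition laurent_act (q : laurent) (v : V) : V :=
  let: exist p qP := cid (asboolP _ (laurent_valP q)) in
  let: exist n _ := cid qP in T (- n%:Z) (peval p v).

Lemma laurent_actE (q : laurent) (p : {poly int}) n v :
  laurent_val q = p%:F / ('X^n)%:F -> laurent_act q v = T (- n%:Z) (peval p v).
Proof.
rewrite /laurent_act; case: cid => p' qP; case: cid => n' -> /eqP.
rewrite eqr_div ?tofracX_neq0 // -!tofracM tofrac_eq => /eqP e.
have {}e : T n (peval p' v) = T n' (peval p v) by rewrite -!pevalMXn e.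
transitivity (T (- n'%:Z - n%:Z) (T n (peval p' v))); first by rewrite -TA subrK.
by rewrite e -TA addrAC addNr add0r.
Qed.

Lemma laurent_common (q r : laurent) : exists (p s : {poly int}) (n : nat),
  laurent_val q = p%:F / ('X^n)%:F /\ laurent_val r = s%:F / ('X^n)%:F.
Proof.
have /asboolP[p [n qE]] := laurent_valP q; have /asboolP[s [m rE]] := laurent_valP r.
exists (p * 'X^m), (s * 'X^n), (n + m)%N; rewrite qE rE exprD !tofracM; split.
  by rewrite -mulf_div divff ?tofracX_neq0 // mulr1.
by rewrite [_ * ('X^m)%:F in RHS]mulrC -mulf_div divff ?tofracX_neq0 // mulr1.
Qed.

Lemma laurent_actA q r v : laurent_act q (laurent_act r v) = laurent_act (q * r) v.
Proof.
have [p [s [n [qE rE]]]] := laurent_common q r.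
rewrite (laurent_actE _ qE) (laurent_actE _ rE).
rewrite (@laurent_actE _ (p * s) (n + n)); last first.
  by rewrite exprD !tofracM -mulf_div -qE -rE.
by rewrite pevalM -!opT_peval -TA PoszD opprD.
Qed.

Lemma laurent_act1 v : laurent_act 1 v = v.
Proof.
rewrite (@laurent_actE _ 1 0) ?oppr0 ?T0 ?peval1 //.
by rewrite expr0 tofrac1 divr1.
Qed.

Lemma laurent_actDr q v w :
  laurent_act q (v + w) = laurent_act q v + laurent_act q w.
Proof.
have [p [_ [n [qE _]]]] := laurent_common q q.
by rewrite !(laurent_actE _ qE) pevalDr TD.
Qed.

Lemma laurent_actDl v q r :
  laurent_act (q + r) v = laurent_act q v + laurent_act r v.
Proof.
have [p [s [n [qE rE]]]] := laurent_common q r.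
rewrite (laurent_actE _ qE) (laurent_actE _ rE) -TD -pevalDl.
by apply: laurent_actE; rewrite tofracD mulrDl -qE -rE.
Qed.

End LaurentAction.

Lemma laurentX_subproof (j : int) : (('X : {poly int})%:F ^ j) \in laurent_pred.
Proof.
apply/asboolP; case: j => n; first by exists 'X^n, 0%N; rewrite expr0 tofrac1 divr1 tofracXn.
by exists 1, n.+1; rewrite tofrac1 div1r tofracXn.
Qed.

(* The monomial x^j. *)
Definition laurentX (j : int) : laurent := Laurent (laurentX_subproof j).

Section K0gr.
Variable R : gradedRing.

Definition K0gr : Type := gcompletion (Vgr R).
HB.instance Definition _ := GRing.Zmodule.on K0gr.

Definition K0gr_class (P : grproj R) : K0gr := gc_class (vclass P).

Definition K0gr_shift (j : int) : K0gr -> K0gr := gc_map (@vshift R j).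

Lemma K0gr_shift0 : K0gr_shift 0 =1 id.
Proof.
move=> x; have [v [w ->]] := gc_class_surj x.
by rewrite /K0gr_shift (gc_mapE (vshiftD _)) !vshift_0.
Qed.

Lemma K0gr_shiftA i j x : K0gr_shift (i + j) x = K0gr_shift i (K0gr_shift j x).
Proof.
have [v [w ->]] := gc_class_surj x; rewrite /K0gr_shift.
rewrite (gc_mapE (vshiftD j)) (gc_mapE (vshiftD i)) (gc_mapE (vshiftD (i + j))).
by rewrite !vshift_add.
Qed.

Lemma K0gr_shiftD i : {morph K0gr_shift i : x y / x + y}.
Proof. exact: gc_mapD (vshiftD _). Qed.

HB.instance Definition _ := GRing.Zmodule_isLmodule.Build laurent K0gr
  (laurent_actA K0gr_shift0 K0gr_shiftA K0gr_shiftD)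
  (laurent_act1 K0gr_shift0 K0gr_shiftA K0gr_shiftD)
  (laurent_actDr K0gr_shift0 K0gr_shiftA K0gr_shiftD)
  (laurent_actDl K0gr_shift0 K0gr_shiftA K0gr_shiftD).

Lemma K0gr_laurentX j P : laurentX j *: K0gr_class P = K0gr_class (gshift j P).
Proof.
transitivity (K0gr_shift j (K0gr_class P)); last first.
  by rewrite /K0gr_shift (gc_map_class (vshiftD j)) vclass_gshift.
have E := laurent_actE K0gr_shift0 K0gr_shiftA K0gr_shiftD (q := laurentX j).
rewrite -[LHS]/(laurent_act _ _ _); case: j E => n E.
  rewrite (E 'X^n 0%N) ?oppr0 ?K0gr_shift0 /= ?expr0 ?tofrac1 ?divr1 ?tofracXn //.
  rewrite -['X^n]mul1r (pevalMXn K0gr_shift0 K0gr_shiftA K0gr_shiftD).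
  by rewrite (peval1 K0gr_shift0).
rewrite (E 1 n.+1) ?(peval1 K0gr_shift0) ?NegzE //= tofrac1 div1r tofracXn.
by [].
Qed.

Definition K0gr_pos : set K0gr := range (@gc_class (Vgr R)).

End K0gr.

Definition K0gr_order_iso (R S : gradedRing) : Prop :=
  exists f : {linear K0gr R -> K0gr S},
    bijective f /\ (f @` @K0gr_pos R = @K0gr_pos S)%classic.

(* Main.v *)
(* Let L = L(E), with A the adjacency matrix of E. Call a family (p_i) of
   homogeneous elements p_i = p_i v_i, all of the same degree, a basis of the
   graded module P when P is the direct sum of the p_i L and p_i L is a copy of
   v_i L. As there are no sinks, v L is the direct sum of the a L with s(a) = v,
   so that the p_i a form another basis, one degree up; in terms of the number of
   basis elements at each vertex this refinement is the multiplication of a row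
   vector by A. A homogeneous element of degree 0 of L maps paths of length n to
   combinations of paths of length n for n large, hence a graded map between
   modules with bases is given, on fine enough refinements, by a matrix over K.

   Applied to an isomorphism, this shows that two bases of a module have the same
   numbers of elements after enough refinements. Applied to the idempotent that
   presents a graded finitely generated projective module (whose generators can be
   moved to a common degree, since 1 is the sum of all a a^*, for a an edge), it
   shows that every such module has a basis. Thus K_0^gr(L) is the direct limit of
   Z^n -> Z^n -> ... along A, ordered by the images of N^n, with x acting as A,
   and an ordered isomorphism of two such limits that commutes with x is a shift
   equivalence once enough powers of the matrices are absorbed. *)
Require Import Defs.
From HB Require Import structures.
From mathcomp Require Import all_boot all_order all_algebra.
From mathcomp Require Import boolp classical_sets.

Set Implicit Arguments.
Unset Strict Implicit.
Unset Printing Implicit Defensive.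

Import Order.TTheory GRing.Theory Num.Theory.

Local Open Scope ring_scope.

(** * Right modules, with the scalar written on the right *)

Definition ract (R : pzRingType) (M : lmodType (op_ring R)) (m : M) (r : R) : M :=
  (r : op_ring R) *: m.

Local Notation "m *> r" := (ract m r) (at level 40, left associativity).

Section RightAction.
Variables (R : pzRingType) (M : lmodType (op_ring R)).
Implicit Types (m : M) (r s : R).

Lemma ractM m r s : m *> r *> s = m *> (r * s).
Proof. exact: scalerA. Qed.
Lemma ract1 m : m *> 1 = m.
Proof. exact: (@scale1r (op_ring R)). Qed.
Lemma ractDl m m' r : (m + m') *> r = m *> r + m' *> r.
Proof. exact: (@scalerDr (op_ring R)). Qed.
Lemma ractDr m r s : m *> (r + s) = m *> r + m *> s.
Proof. exact: (@scalerDl (op_ring R)). Qed.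
Lemma ractBr m r s : m *> (r - s) = m *> r - m *> s.
Proof. exact: (@scalerBl (op_ring R)). Qed.
Lemma ract0 m : m *> 0 = 0.
Proof. exact: (@scale0r (op_ring R)). Qed.
Lemma ract0l r : (0 : M) *> r = 0.
Proof. exact: (@scaler0 (op_ring R)). Qed.
Lemma ract_suml (I : Type) (s : seq I) (P : pred I) (F : I -> M) r :
  (\sum_(i <- s | P i) F i) *> r = \sum_(i <- s | P i) F i *> r.
Proof. exact: (@scaler_sumr (op_ring R)). Qed.
Lemma ract_sumr (I : Type) (s : seq I) (P : pred I) (F : I -> R) m :
  m *> (\sum_(i <- s | P i) F i) = \sum_(i <- s | P i) m *> F i.
Proof. exact: (@scaler_suml (op_ring R)). Qed.
Lemma linear_ract (N : lmodType (op_ring R)) (f : {linear M -> N}) m r :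
  f (m *> r) = f m *> r.
Proof. exact: linearZ. Qed.
Lemma linear_ract_sum (N : lmodType (op_ring R)) (f : {linear M -> N}) (I : Type)
    (s : seq I) (P : pred I) (F : I -> M) (c : I -> R) :
  f (\sum_(i <- s | P i) F i *> c i) = \sum_(i <- s | P i) f (F i) *> c i.
Proof. by rewrite raddf_sum; apply: eq_bigr => i _; apply: linear_ract. Qed.

End RightAction.

(** * Homogeneous components of an internal grading *)

Section GradedProjection.
Variables (V : zmodType) (C : int -> V -> Prop) (gC : internal_grading C).

Lemma grD i x y : C i x -> C i y -> C i (x + y).
Proof.
move=> cx cy; have cN := gradingB gC (grading0 gC i) cy.
by have := gradingB gC cx cN; rewrite sub0r opprK.
Qed.

Lemma gr_sum i (I : Type) (s : seq I) (P : pred I) (F : I -> V) :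
  (forall j, P j -> C i (F j)) -> C i (\sum_(j <- s | P j) F j).
Proof.
by move=> cF; elim/big_ind: _ => //; [apply: grading0 gC i|apply: grD].
Qed.

Lemma gr_big_split (s : seq (int * V)) (t : seq int) :
  uniq t -> {subset [seq p.1 | p <- s] <= t} ->
  \sum_(p <- s) p.2 = \sum_(i <- t) \sum_(p <- s | p.1 == i) p.2.
Proof.
move=> ut st; rewrite (exchange_big_dep xpredT) //= big_seq [RHS]big_seq.
apply: eq_bigr => p ps; rewrite -big_filter.
have /(perm_big _) -> : perm_eq [seq i <- t | p.1 == i] [:: p.1].
  apply: uniq_perm; rewrite ?filter_uniq // => i; rewrite mem_filter inE eq_sym.
  by case: eqP => [->|] //=; rewrite st // map_f.
by rewrite big_seq1.
Qed.

(** The degreewise differences of the two sums form a homogeneous family with sum zero, so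
    [grading_free] kills each of them. *)
Lemma gr_comp_unique (s t : seq (int * V)) i :
  (forall p, p \in s -> C p.1 p.2) -> (forall p, p \in t -> C p.1 p.2) ->
  \sum_(p <- s) p.2 = \sum_(p <- t) p.2 ->
  \sum_(p <- s | p.1 == i) p.2 = \sum_(p <- t | p.1 == i) p.2.
Proof.
move=> cs ct e; pose u := undup (i :: [seq p.1 | p <- s ++ t]).
have cF (r : seq (int * V)) j : (forall p, p \in r -> C p.1 p.2) ->
    C j (\sum_(p <- r | p.1 == j) p.2).
  move=> cr; rewrite big_seq_cond; apply: gr_sum => p /andP[/cr + /eqP pj].
  by rewrite pj.
apply/eqP; rewrite -subr_eq0; apply/eqP.
apply: (grading_free gC (s := u)
  (f := fun j => \sum_(p <- s | p.1 == j) p.2 - \sum_(p <- t | p.1 == j) p.2)).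
- exact: undup_uniq.
- by move=> j; apply: (gradingB gC); apply: cF.
- rewrite sumrB -!gr_big_split ?undup_uniq ?e ?subrr // => j jt;
  by rewrite mem_undup inE map_cat mem_cat jt !orbT.
- by rewrite mem_undup mem_head.
Qed.

Definition gr_seq (x : V) : seq (int * V) :=
  sval (cid2 (grading_span gC x)).

Lemma gr_seq_comp x p : p \in gr_seq x -> C p.1 p.2.
Proof. by rewrite /gr_seq; case: cid2 => s /= cs _; apply: cs. Qed.

Lemma gr_seq_sum x : x = \sum_(p <- gr_seq x) p.2.
Proof. by rewrite /gr_seq; case: cid2. Qed.

(** The projection onto degree [i]. It is read off a chosen decomposition of [x]; by [gprE] any
    other decomposition gives the same value. *)
Definition gpr (i : int) (x : V) : V := \sum_(p <- gr_seq x | p.1 == i) p.2.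

Lemma gprE i (s : seq (int * V)) : (forall p, p \in s -> C p.1 p.2) ->
  gpr i (\sum_(p <- s) p.2) = \sum_(p <- s | p.1 == i) p.2.
Proof.
move=> cs; apply: gr_comp_unique => //; first exact: gr_seq_comp.
by rewrite -gr_seq_sum.
Qed.

Lemma gpr_comp i x : C i (gpr i x).
Proof.
rewrite /gpr big_seq_cond; apply: gr_sum => p /andP[/gr_seq_comp + /eqP pi].
by rewrite pi.
Qed.

Lemma gpr_id i j x : C i x -> gpr j x = if i == j then x else 0.
Proof.
move=> cx; have := @gprE j [:: (i, x)]; rewrite big_seq1 big_mkcond big_seq1 /=.
by apply=> p; rewrite inE => /eqP ->.
Qed.

Lemma gprD i x y : gpr i (x + y) = gpr i x + gpr i y.
Proof.
rewrite {1}(gr_seq_sum x) {1}(gr_seq_sum y) -big_cat gprE ?big_cat // => p.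
by rewrite mem_cat => /orP[] /gr_seq_comp.
Qed.

Lemma gpr0 i : gpr i 0 = 0.
Proof. by apply: (addrI (gpr i 0)); rewrite -gprD !addr0. Qed.

Lemma gpr_sum i (I : Type) (s : seq I) (P : pred I) (F : I -> V) :
  gpr i (\sum_(j <- s | P j) F j) = \sum_(j <- s | P j) gpr i (F j).
Proof. exact: (big_morph _ (gprD i) (gpr0 i)). Qed.

Lemma gr_ind (Q : V -> Prop) :
  (forall x y, Q x -> Q y -> Q (x + y)) -> Q 0 ->
  (forall i x, C i x -> Q x) -> forall x, Q x.
Proof.
move=> QD Q0 Qh x; rewrite (gr_seq_sum x) big_seq.
by elim/big_ind: _ => // p /gr_seq_comp; apply: Qh.
Qed.

(* When the pr i are the homogeneous projections of W, this is the part of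
   degree zero of f. *)
Definition degree0_part (W : zmodType) (pr : int -> W -> W) (f : V -> W) (x : V) : W :=
  \sum_(p <- gr_seq x) pr p.1 (f p.2).

(** Independence of the decomposition: two decompositions of an element agree once grouped by
    degree, and each [pr i] after [f] is additive, hence compatible with the grouping. *)
Lemma degree0_partE (W : zmodType) (pr : int -> W -> W) (f : V -> W)
    (s : seq (int * V)) :
  {morph f : x y / x + y} -> (forall i, {morph pr i : x y / x + y}) ->
  (forall p, p \in s -> C p.1 p.2) ->
  degree0_part pr f (\sum_(p <- s) p.2) = \sum_(p <- s) pr p.1 (f p.2).
Proof.
move=> fD prD cs.
have F0 i : pr i (f 0) = 0.
  have f0 : f 0 = 0 by apply: (addrI (f 0)); rewrite -fD !addr0.
  by apply: (addrI (pr i 0)); rewrite f0 -prD !addr0.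
have regroup (r : seq (int * V)) (u : seq int) : uniq u ->
    {subset [seq p.1 | p <- r] <= u} ->
    \sum_(p <- r) pr p.1 (f p.2) =
    \sum_(i <- u) pr i (f (\sum_(p <- r | p.1 == i) p.2)).
  move=> uu ru; have FD i : {morph (fun x => pr i (f x)) : x y / x + y}.
    by move=> x y; rewrite fD prD.
  under [RHS]eq_bigr => i _ do rewrite (big_morph _ (FD i) (F0 i)).
  rewrite (exchange_big_dep xpredT) //= big_seq [RHS]big_seq.
  apply: eq_bigr => p pr'; rewrite -big_filter.
  have /(perm_big _) -> : perm_eq [seq i <- u | p.1 == i] [:: p.1].
    apply: uniq_perm; rewrite ?filter_uniq // => i; rewrite mem_filter inE eq_sym.
    by case: eqP => [->|] //=; rewrite ru // map_f.
  by rewrite big_seq1.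
rewrite /degree0_part; set x := \sum_(p <- s) p.2.
pose u := undup ([seq p.1 | p <- s ++ gr_seq x]).
rewrite !(regroup _ u) ?undup_uniq //; last 2 first.
- by move=> j jt; rewrite mem_undup map_cat mem_cat jt ?orbT.
- by move=> j jt; rewrite mem_undup map_cat mem_cat jt ?orbT.
apply: eq_bigr => i _; congr (pr i (f _)); apply: gr_comp_unique => //.
  exact: gr_seq_comp.
by rewrite -gr_seq_sum.
Qed.

End GradedProjection.

(** * Generators, scalars and path spans in the Leavitt path algebra *)

Section LeavittElements.
Variables (K : fieldType) (E : digraph).
Local Notation L := (leavitt_gr K E).
Implicit Types (v w : vert E) (a b : edge E) (x y z : L) (k : K).

Definition lv v : L := lpa_pi (LGen K (LVert v)).
Definition le a : L := lpa_pi (LGen K (LEdge a)).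
Definition lg a : L := lpa_pi (LGen K (LGhost a)).
(** The scalar [k] as a central element of the algebra. Through it [K] acts on right modules, whose
    type carries no [K]-structure. *)
Definition lsc k : L := k *: (1 : leavitt K E).

Lemma lv_lv v w : lv v * lv w = if v == w then lv v else 0.
Proof. exact: lpa_vertM. Qed.
Lemma lv_idem v : lv v * lv v = lv v.
Proof. by rewrite lv_lv eqxx. Qed.
Lemma lv_le v a : lv v * le a = if v == src a then le a else 0.
Proof.
have e : lv (src a) * le a = le a := lpa_pi_mul (lr_src K a).
by rewrite -{1}e mulrA lv_lv; case: eqP => [->|_]; rewrite ?mul0r ?e.
Qed.
Lemma le_lv a v : le a * lv v = if v == rng a then le a else 0.
Proof.
have e : le a * lv (rng a) = le a := lpa_pi_mul (lr_rng K a).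
by rewrite -{1}e -mulrA lv_lv eq_sym; case: eqP => _; rewrite ?mulr0 ?e.
Qed.
Lemma lg_lv a v : lg a * lv v = if v == src a then lg a else 0.
Proof.
have e : lg a * lv (src a) = lg a := lpa_pi_mul (lr_srcG K a).
by rewrite -{1}e -mulrA lv_lv eq_sym; case: eqP => _; rewrite ?mulr0 ?e.
Qed.
Lemma lg_le a b : lg a * le b = if a == b then lv (rng a) else 0.
Proof.
transitivity (lpa_pi (if a == b then LGen K (LVert (rng a)) else LZero K E)).
  exact: lpa_pi_mul (lr_CK1 K a b).
by case: ifP.
Qed.

Lemma CK2_sum v : (exists a, src a = v) ->
  \sum_(a | src a == v) le a * lg a = lv v.
Proof.
move=> va; rewrite /lv -((lpa_piP _ _).2 (lr_CK2 K va)) /lpa_CK2_term.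
transitivity (\sum_(a <- enum (edge E) | src a == v) le a * lg a).
  by rewrite big_enum_cond.
rewrite -big_filter; elim: [seq _ <- _ | _] => [|a r IH] /=; first by rewrite big_nil.
by rewrite big_cons IH -lpa_addE -lpa_mulE.
Qed.

Lemma sum_lv : \sum_v lv v = 1.
Proof. by []. Qed.

Lemma sum_le_lg : no_sinks E -> \sum_a le a * lg a = 1.
Proof.
move=> hE; rewrite -sum_lv (partition_big (@src E) xpredT) //=.
by apply: eq_bigr => v _; rewrite CK2_sum.
Qed.

Lemma lscC k x : lsc k * x = x * lsc k.
Proof. by rewrite /lsc -lpa_scaleAl mul1r -lpa_scaleAr mulr1. Qed.
Lemma lscM k l : lsc k * lsc l = lsc (k * l).
Proof. by rewrite /lsc -lpa_scaleAl mul1r scalerA. Qed.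
Lemma lscD k l : lsc (k + l) = lsc k + lsc l.
Proof. exact: scalerDl. Qed.
Lemma lsc1 : lsc 1 = 1.
Proof. exact: scale1r. Qed.
Lemma lsc0 : lsc 0 = 0.
Proof. exact: scale0r. Qed.
Lemma lsc_sum (I : Type) (s : seq I) (P : pred I) (F : I -> K) :
  lsc (\sum_(i <- s | P i) F i) = \sum_(i <- s | P i) lsc (F i).
Proof. exact: (big_morph _ lscD lsc0). Qed.
Lemma lscE k x : lsc k * x = k *: (x : leavitt K E).
Proof. by rewrite /lsc -lpa_scaleAl mul1r. Qed.
Lemma lsc_nat (b : bool) : lsc b%:R = b%:R.
Proof. by case: b; rewrite ?lsc1 ?lsc0. Qed.

Lemma lv_comp v : gring_comp 0 (lv v).
Proof. exact: (@lc_gen K E (LVert v)). Qed.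
Lemma le_comp a : gring_comp 1 (le a).
Proof. exact: (@lc_gen K E (LEdge a)). Qed.

(* The linear span of the paths of length n. *)
Inductive lpath : nat -> L -> Prop :=
  | lp_vert v : lpath 0 (lv v)
  | lp_zero n : lpath n 0
  | lp_add n x y : lpath n x -> lpath n y -> lpath n (x + y)
  | lp_scale n x k : lpath n x -> lpath n (x * lsc k)
  | lp_edge n a x : lpath n x -> lpath n.+1 (le a * x).

Lemma lpath_vert v n x : lpath n x -> lpath n (lv v * x).
Proof.
elim=> {n x}.
- by move=> w; rewrite lv_lv; case: ifP => _; [apply: lp_vert|apply: lp_zero].
- by move=> n; rewrite mulr0; apply: lp_zero.
- by move=> n x y _ cx _ cy; rewrite mulrDr; apply: lp_add.
- by move=> n x k _ cx; rewrite mulrA; apply: lp_scale.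
- move=> n a x px _; rewrite mulrA lv_le; case: ifP => _; first exact: lp_edge.
  by rewrite mul0r; apply: lp_zero.
Qed.

(** The ghost edge cancels against the first edge of each path. *)
Lemma lpath_ghost a n x : lpath n.+1 x -> lpath n (lg a * x).
Proof.
move e: n.+1 => m px; elim: px n e => {m x}.
- by [].
- by move=> m n _; rewrite mulr0; apply: lp_zero.
- by move=> m x y _ IHx _ IHy n e; rewrite mulrDr; apply: lp_add; auto.
- by move=> m x k _ IHx n e; rewrite mulrA; apply: lp_scale; auto.
- move=> m b x px _ n [->]; rewrite mulrA lg_le; case: ifP => _.
    exact: lpath_vert.
  by rewrite mul0r; apply: lp_zero.
Qed.

(* A homogeneous element involves ghost edges of a bounded total number, and
   those are absorbed by the initial edges of a long enough path. *)
Lemma comp_mul_lpath i x : gring_comp i x -> exists k : nat, forall m : nat,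
  (k <= m)%N -> exists2 m' : nat, m'%:Z = m%:Z + i &
    forall y, lpath m y -> lpath m' (x * y).
Proof.
elim=> {i x}.
- case=> [v|a|a].
  + exists 0%N => m _; exists m; first by rewrite addr0.
    by move=> y; apply: lpath_vert.
  + exists 0%N => m _; exists m.+1; first by rewrite -addn1 PoszD.
    by move=> y; apply: lp_edge.
  + exists 1%N => -[//|m] _; exists m; last by move=> y; apply: lpath_ghost.
    by rewrite -addn1 PoszD addrK.
(* For the zero element only the lengths matter: [m >= |i|] makes [m + i] a natural number. *)
- move=> i; exists (absz i) => m im; exists (absz (m%:Z + i)); last first.
    by move=> y _; rewrite mul0r; apply: lp_zero.
  have : 0 <= m%:Z + i.
    rewrite -lerBlDr sub0r; apply: (le_trans (ler_norm _)).
    by rewrite normrN -abszE lez_nat.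
  by case: (m%:Z + i).
- move=> i x y _ [k IHx] _ [l IHy]; exists (maxn k l) => m.
  rewrite geq_max => /andP[/IHx[m' em' hx] /IHy[m'' em'' hy]]; exists m' => // z pz.
  rewrite mulrDl; apply: lp_add; first exact: hx.
  have -> : m' = m'' by apply/eqP; rewrite -eqz_nat em' em''.
  exact: hy.
- move=> i k x _ [l IHx]; exists l => m /IHx[m' em' hx]; exists m' => // z pz.
  rewrite -[k *: x]lscE lscC -mulrA lscC mulrA; apply: lp_scale; exact: hx.
(* The factor [y] needs length at least [l]; the length [m + j] then offered to [x] is at least [k]
   because [m >= k + |j|]. *)
- move=> i j x y _ [k IHx] _ [l IHy]; exists (maxn l (k + `|j|)) => m.
  rewrite geq_max => /andP[/IHy[m' em' hy] km].
  have km' : (k <= m')%N.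
    rewrite -lez_nat em'.
    have h : (k + `|j|)%N%:Z <= m%:Z by rewrite lez_nat.
    rewrite -lerBlDr; apply: le_trans h; rewrite PoszD lerD2l.
    by apply: (le_trans (ler_norm _)); rewrite normrN abszE.
  have [m'' em'' hx] := IHx _ km'; exists m''.
    by rewrite em'' em' addrAC addrA.
  by move=> z pz; rewrite -mulrA; apply/hx/hy.
Qed.

End LeavittElements.

(** * Vertices are nonzero: the representation on infinite paths *)

Section VertexNonzero.
Variables (K : fieldType) (E : digraph).

Local Notation stream := (nat -> edge E).

Definition valid (p : stream) : bool := `[< forall i, rng (p i) = src (p i.+1) >].
Definition scons (a : edge E) (p : stream) : stream :=
  fun i => if i is j.+1 then p j else a.
Definition stail (p : stream) : stream := fun i => p i.+1.

Lemma valid_scons a p : src (p 0%N) = rng a -> valid (scons a p) = valid p.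
Proof.
move=> pa; apply/asboolP/asboolP => vp i; first exact: vp i.+1.
by case: i => [|i] /=; rewrite ?pa ?vp.
Qed.
Lemma valid_stail p : valid p -> valid (stail p).
Proof. by move=> /asboolP vp; apply/asboolP => i; apply: vp. Qed.
Lemma valid0 p : valid p -> src (p 1%N) = rng (p 0%N).
Proof. by move=> /asboolP ->. Qed.
Lemma scons_stail p : scons (p 0%N) (stail p) = p.
Proof. by apply/funext => -[]. Qed.

(* The representation of the Leavitt path algebra on the functions on infinite
   paths: a * delta_p = delta_(ap), with every stream that is not a path sent
   to zero. *)
Fixpoint lpa_rep (t : lpa_term K E) (f : stream -> K) (p : stream) : K :=
  match t with
  | LGen (LVert v) => if valid p && (src (p 0%N) == v) then f p else 0
  | LGen (LEdge a) => if valid p && (p 0%N == a) then f (stail p) else 0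
  | LGen (LGhost a) => if valid p && (src (p 0%N) == rng a) then f (scons a p) else 0
  | LZero => 0
  | LOpp t => - lpa_rep t f p
  | LAdd t u => lpa_rep t f p + lpa_rep u f p
  | LMul t u => lpa_rep t (lpa_rep u f) p
  | LScale k t => k * lpa_rep t f p
  end.

Lemma lpa_repD t f g :
  lpa_rep t (fun p => f p + g p) = fun p => lpa_rep t f p + lpa_rep t g p.
Proof.
elim: t f g => [[v|a|a]||t IH|t IHt u IHu|t IHt u IHu|k t IH] f g;
  apply/funext => p /=; do ?by case: ifP; rewrite ?addr0.
- by rewrite addr0.
- by rewrite IH opprD.
- by rewrite IHt IHu addrACA.
- by rewrite IHu IHt.
- by rewrite IH mulrDr.
Qed.

Lemma lpa_repZ t k f : lpa_rep t (fun p => k * f p) = fun p => k * lpa_rep t f p.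
Proof.
elim: t f => [[v|a|a]||t IH|t IHt u IHu|t IHt u IHu|l t IH] f;
  apply/funext => p /=; do ?by case: ifP; rewrite ?mulr0.
- by rewrite mulr0.
- by rewrite IH mulrN.
- by rewrite IHt IHu mulrDr.
- by rewrite IHu IHt.
- by rewrite IH mulrCA.
Qed.

Lemma lpa_rep_rel t u : lpa_rel t u -> lpa_rep t = lpa_rep u.
Proof.
elim=> {t u} /=.
- by [].
- by move=> t u _ ->.
- by move=> t u w _ -> _ ->.
- by move=> t t' _ IH; apply/funext => f; rewrite /= IH.
- by move=> t t' u u' _ IHt _ IHu; apply/funext => f; rewrite /= IHt IHu.
- by move=> t t' u u' _ IHt _ IHu; apply/funext => f; rewrite /= IHt IHu.
- by move=> k t t' _ IH; apply/funext => f; rewrite /= IH.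
- by move=> t u w; apply/funext => f; apply/funext => p /=; rewrite addrA.
- by move=> t u; apply/funext => f; apply/funext => p /=; rewrite addrC.
- by move=> t; apply/funext => f; apply/funext => p /=; rewrite add0r.
- by move=> t; apply/funext => f; apply/funext => p /=; rewrite addNr.
- by [].
- by [].
- by move=> t u w; apply/funext => f; rewrite /= lpa_repD.
- by move=> a b t; apply/funext => f; apply/funext => p /=; rewrite mulrA.
- by move=> t; apply/funext => f; apply/funext => p /=; rewrite mul1r.
- by move=> a t u; apply/funext => f; apply/funext => p /=; rewrite mulrDr.
- by move=> a b t; apply/funext => f; apply/funext => p /=; rewrite mulrDl.
- by [].
- by move=> a t u; apply/funext => f; rewrite /= lpa_repZ.
- move=> v w; apply/funext => f; apply/funext => p.
  have [->|vw] := eqVneq v w => /=; first by case: ifP => // ->.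
  case: andP => // -[vp /eqP pv]; case: andP => // -[_ /eqP pw].
  by rewrite -pv -pw eqxx in vw.
- move=> a; apply/funext => f; apply/funext => p /=.
  case: (boolP (valid p)) => //= vp; case: (eqVneq (p 0%N) a) => [->|_].
    by rewrite eqxx.
  by case: ifP => // ->.
- move=> a; apply/funext => f; apply/funext => p /=.
  case: andP => // -[vp /eqP pa].
  by rewrite valid_stail //= /stail (valid0 vp) pa eqxx.
- move=> a; apply/funext => f; apply/funext => p /=.
  by case: ifP => // ->.
- move=> a; apply/funext => f; apply/funext => p /=.
  case: andP => // -[vp /eqP pa].
  by rewrite valid_scons // vp /= eqxx.
- move=> a b; apply/funext => f; apply/funext => p.
  have [->|ab] := eqVneq a b => /=.
    case: andP => // -[vp /eqP pa]; rewrite valid_scons // vp /=.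
    by congr (f _); apply/funext.
  by rewrite andbF if_same.
(* Each a a^* acts as the restriction to the paths with first edge [a], so on a path [p] only the
   edge [p 0] can contribute to the sum. *)
- move=> v _; apply/funext => f; apply/funext => p; rewrite /lpa_CK2_term.
  transitivity (\sum_(a <- enum (edge E) | src a == v)
                 if valid p && (p 0%N == a) then f p else 0).
    rewrite -big_filter; elim: [seq _ <- _ | _] => [|a r IH] /=.
      by rewrite big_nil.
    rewrite big_cons IH; congr (_ + _); case: andP => // -[vp /eqP pa].
    by rewrite valid_stail //= /stail (valid0 vp) pa eqxx -pa scons_stail.
  rewrite big_enum_cond /=; case: (boolP (valid p)) => //= vp; last first.
    by apply: big1.
  rewrite -big_mkcondr /=; case: eqP => pv.
    rewrite (big_pred1 (p 0%N)) // => a /=; rewrite [_ == a]eq_sym.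
    by case: (eqVneq a (p 0%N)) => [->|_]; rewrite ?andbF // pv eqxx.
  by rewrite big_pred0 // => a; apply/andP => -[/eqP av /eqP pa]; case: pv; rewrite pa.
Qed.

(** The element acts on the constant function 1, and the result is evaluated at an infinite path
    from [v]. Such a path exists because every vertex emits an edge. *)
Lemma lsc_lv_eq0 (k : K) (v : vert E) : no_sinks E ->
  lsc E k * lv K v = 0 -> k = 0.
Proof.
move=> hE; rewrite lscE -[_ *: _]/(lpa_scale _ _) lpa_scaleE => /lpa_piP /lpa_rep_rel.
have [next nextP] := choice hE.
pose p i := iter i (fun a => next (rng a)) (next v).
move=> /(congr1 (fun F => F (fun=> 1) p)) /=.
have -> : valid p by apply/asboolP => i; rewrite /p iterS nextP.
by rewrite nextP eqxx mulr1.
Qed.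

End VertexNonzero.

(** * Graded modules with a basis *)

Lemma gpr_ract (R : gradedRing) (M : grmod R) i j (m : M) (r : R) : gcomp i m ->
  gpr (gcomp_grading M) (i + j) (m *> r) = m *> gpr (gring_grading R) j r.
Proof.
move=> cm; elim/(gr_ind (gring_grading R)): r => [x y IHx IHy||k x cx].
- by rewrite ractDr !gprD ractDr IHx IHy.
- by rewrite ract0 !gpr0 ract0.
- rewrite (gpr_id _ (i := i + k)) ?(gpr_id _ _ cx); last exact: gcompZ.
  by rewrite (inj_eq (addrI i)); case: eqP => _; rewrite ?ract0.
Qed.

Lemma gpr_ractl (R : gradedRing) (M : grmod R) i k (m : M) (r : R) :
  gring_comp k r ->
  gpr (gcomp_grading M) (i + k) (m *> r) = gpr (gcomp_grading M) i m *> r.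
Proof.
move=> cr; elim/(gr_ind (gcomp_grading M)): m => [x y IHx IHy||j x cx].
- by rewrite ractDl !gprD ractDl IHx IHy.
- by rewrite ract0l !gpr0 ract0l.
- rewrite (gpr_id _ _ cx) (gpr_id _ (i := j + k)); last exact: gcompZ.
  by rewrite (inj_eq (addIr k)); case: eqP => _; rewrite ?ract0l.
Qed.

Section GradedBasis.
Variables (K : fieldType) (E : digraph).
Local Notation L := (leavitt_gr K E).
Local Notation lv := (lv K).

(* P is the direct sum of the p_i L, and x |-> p_i x is an isomorphism from
   (vs i)L to p_i L. *)
Record gbasis (P : grmod L) (I : finType) (vs : I -> vert E) (d : int)
    (p : I -> P) : Prop := GBasis {
  gb_comp : forall i, gcomp d (p i);
  gb_vert : forall i, p i *> lv (vs i) = p i;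
  gb_span : forall x, exists c : I -> L, x = \sum_i p i *> c i;
  gb_free : forall c : I -> L, \sum_i p i *> c i = 0 ->
    forall i, lv (vs i) * c i = 0 }.

Section Lift.
Variables (P : grmod L) (I : finType) (vs : I -> vert E) (d : int) (p : I -> P).
Hypothesis bp : gbasis vs d p.

(** Taking the component of degree [j - d] of each coefficient amounts to taking the component of
    degree [j] of the sum, which is [x] itself. *)
Lemma gb_spanh j x : gcomp j x -> exists2 c : I -> L,
  (forall i, gring_comp (j - d) (c i)) & x = \sum_i p i *> c i.
Proof.
move=> cx; have [c xE] := gb_span bp x.
exists (fun i => gpr (gring_grading L) (j - d) (c i)).
  by move=> i; apply: gpr_comp.
transitivity (gpr (gcomp_grading P) j x); first by rewrite (gpr_id _ _ cx) eqxx.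
rewrite {1}xE gpr_sum; apply: eq_bigr => i _.
by rewrite -(gpr_ract _ _ (gb_comp bp i)) addrC subrK.
Qed.

(** The universal property of a basis. By freeness the coefficients [c i] of an element are
    determined up to [lv (vs i) * c i], and [q i] sees no more of them since it is fixed by its
    vertex. *)
Lemma gb_lift (Q : grmod L) (q : I -> Q) :
  (forall i, gcomp d (q i)) -> (forall i, q i *> lv (vs i) = q i) ->
  exists2 f : {linear P -> Q}, (forall i, f (p i) = q i) &
    forall j x, gcomp j x -> gcomp j (f x).
Proof.
move=> cq vq; have [c cE] := choice (gb_span bp).
have wd (a b : I -> L) : \sum_i p i *> a i = \sum_i p i *> b i ->
    \sum_i q i *> a i = \sum_i q i *> b i.
  move=> ab; have /(gb_free bp) e : \sum_i p i *> (a i - b i) = 0.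
    by under eq_bigr => i _ do rewrite ractBr; rewrite sumrB ab subrr.
  apply: eq_bigr => i _; rewrite -(vq i) !ractM; congr (_ *> _).
  by apply/eqP; rewrite -subr_eq0 -mulrBr e.
pose f x : Q := \sum_i q i *> c x i.
have fE b : f (\sum_i p i *> b i) = \sum_i q i *> b i by apply/wd/esym/cE.
have lf : linear f.
  move=> r x y; have e : r *: x + y = \sum_i p i *> (c x i * (r : L) + c y i).
    under eq_bigr => i _ do rewrite ractDr -ractM.
    by rewrite big_split /= -ract_suml -!cE.
  rewrite e fE; under eq_bigr => i _ do rewrite ractDr -ractM.
  by rewrite big_split /= -ract_suml.
exists (linear_pack lf) => [i|j x /gb_spanh[b cb ->]] /=.
  have -> : p i = \sum_k p k *> (if k == i then 1 else 0).
    rewrite (bigD1 i) //= eqxx ract1 big1 ?addr0 // => k /negPf ->.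
    by rewrite ract0.
  rewrite fE (bigD1 i) //= eqxx ract1 big1 ?addr0 // => k /negPf ->.
  by rewrite ract0.
rewrite fE; apply: (gr_sum (gcomp_grading Q)) => i _.
by rewrite -[j](subrK d) addrC; apply: gcompZ.
Qed.

End Lift.

Lemma gb_iso (P Q : grmod L) (I : finType) (vs : I -> vert E) d
    (p : I -> P) (q : I -> Q) : gbasis vs d p -> gbasis vs d q -> gr_iso P Q.
Proof.
move=> bp bq.
have [f fp cf] := gb_lift bp (gb_comp bq) (gb_vert bq).
have [g gq cg] := gb_lift bq (gb_comp bp) (gb_vert bp).
have fK : cancel f g.
  move=> x; have [c ->] := gb_span bp x; rewrite !linear_ract_sum.
  by apply: eq_bigr => i _; rewrite fp gq.
have gK : cancel g f.
  move=> x; have [c ->] := gb_span bq x; rewrite !linear_ract_sum.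
  by apply: eq_bigr => i _; rewrite gq fp.
exists f; split; first by exists g.
by move=> i x; split; [apply: cf|move/cg; rewrite fK].
Qed.

Lemma gb_reindex (P : grmod L) (I J : finType) (vs : I -> vert E) d (p : I -> P)
    (h : J -> I) : bijective h -> gbasis vs d p -> gbasis (vs \o h) d (p \o h).
Proof.
move=> [h' hK h'K] [cp vp sp fp]; have bh : bijective h by exists h'.
split=> [i|i|x|c c0 i] //=.
- have [c ->] := sp x; exists (c \o h).
  by rewrite (reindex h) //=; apply: onW_bij.
- have := fp (c \o h') _ (h i); rewrite /= hK; apply.
  rewrite (reindex h) /=; last exact: onW_bij.
  by rewrite -[RHS]c0; apply: eq_bigr => j _; rewrite /= hK.
Qed.

(** * The right ideals generated by the vertices, their sums and their shifts *)

Section VertexModule.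
Variable v : vert E.

Definition vmod_pred : {pred (op_ring L)^o} := fun x => lv v * (x : L) == x.

Lemma vmod_submod : submod_closed vmod_pred.
Proof.
split; first by apply/eqP; rewrite mulr0.
move=> r x y /eqP vx /eqP vy; apply/eqP; rewrite -[r *: x]/((x : L) * (r : L)).
by rewrite [LHS](mulrDr (lv v)) mulrA vx vy.
Qed.

HB.instance Definition _ :=
  GRing.isSubmodClosed.Build (op_ring L) (op_ring L)^o vmod_pred vmod_submod.

Record vmod := VMod { vmod_val :> (op_ring L)^o; vmod_valP : vmod_val \in vmod_pred }.

HB.instance Definition _ := [isSub for vmod_val].
HB.instance Definition _ := [Choice of vmod by <:].
HB.instance Definition _ := [SubChoice_isSubLmodule of vmod by <:].

Definition vmod_comp (i : int) (x : vmod) : Prop := gring_comp i (vmod_val x : L).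

End VertexModule.
End GradedBasis.

Section VertexProjective.
Variables (K : fieldType) (E : digraph).
Local Notation L := (leavitt_gr K E).
Local Notation lv := (lv K).
Local Notation vmod := (vmod K).

Lemma vmod_mem (v : vert E) (x : L) : lv v * x \in @vmod_pred K E v.
Proof. by apply/eqP; rewrite mulrA lv_idem. Qed.

Definition vmod_of (v : vert E) (x : L) : vmod v := VMod (vmod_mem v x).

Lemma vmodK (v : vert E) (x : vmod v) : lv v * (vmod_val x : L) = vmod_val x.
Proof. by apply/eqP; apply: (vmod_valP x). Qed.

Lemma vmod_inj (v : vert E) (x y : vmod v) :
  (vmod_val x : L) = vmod_val y -> x = y.
Proof. exact: val_inj. Qed.

Lemma vmod_val_sum (v : vert E) (I : Type) (s : seq I) (F : I -> vmod v) :
  (vmod_val (\sum_(i <- s) F i) : L) = \sum_(i <- s) (vmod_val (F i) : L).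
Proof. by elim/big_rec2: _ => // i y x _ <-. Qed.

Lemma vmod_grading (v : vert E) : internal_grading (@vmod_comp K E v).
Proof.
have gL := gring_grading L; split=> [i|i x y cx cy|x|s f us cf f0 i si].
- exact: (grading0 gL).
- exact: (gradingB gL).
(* Left multiplication by [v], of degree 0, moves the components of [x] into the right ideal and
   preserves their sum, as [v x = x]. *)
- exists [seq (p.1, vmod_of v p.2) | p <- gr_seq gL (vmod_val x : L)].
    move=> _ /mapP[p /gr_seq_comp cp ->]; rewrite /vmod_comp /=.
    by rewrite -[p.1]add0r; apply: lc_mul => //; apply: lv_comp.
  apply: vmod_inj; rewrite big_map vmod_val_sum /=.
  by rewrite -mulr_sumr -gr_seq_sum vmodK.
- apply: vmod_inj; apply: (grading_free gL (f := fun i => vmod_val (f i) : L) us) => //.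
  by rewrite -vmod_val_sum f0.
Qed.

Lemma vmod_compZ (v : vert E) i j (m : vmod v) (r : L) :
  vmod_comp i m -> gring_comp j r -> vmod_comp (i + j) ((r : op_ring L) *: m).
Proof. exact: gring_compM. Qed.

Definition vgrmod (v : vert E) : grmod L :=
  @GrMod L (vmod v : lmodType (op_ring L)) _ (vmod_grading v) (@vmod_compZ v).

Lemma vmod_ract (v : vert E) (x : vgrmod v) (r : L) :
  (vmod_val (x *> r) : L) = (vmod_val x : L) * r.
Proof. by []. Qed.

Lemma vmod_genE (v : vert E) (x : vgrmod v) :
  x = (vmod_of v 1 : vgrmod v) *> (vmod_val x : L).
Proof. by apply: vmod_inj; rewrite vmod_ract /= mulr1 vmodK. Qed.

Lemma vgrmod_fg (v : vert E) : fin_generated (vgrmod v).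
Proof.
exists 1%N, (fun=> vmod_of v 1) => x; exists (fun=> vmod_val x : L).
by rewrite big_ord1; apply: vmod_genE.
Qed.

(** The generator is [v] itself, so a lift is [x |-> m x], where [m] is a preimage of the image of
    the generator. *)
Lemma vgrmod_proj (v : vert E) : projective (vgrmod v).
Proof.
move=> M N g f gs; have [m mE] := gs (f (vmod_of v 1)).
have lh : linear (fun x : vgrmod v => m *> (vmod_val x : L)).
  by move=> r x y; rewrite -[r *: x + y]/(x *> (r : L) + y) ractDr -ractM.
exists (linear_pack lh) => x /=.
by rewrite linear_ract mE -linear_ract -vmod_genE.
Qed.

Definition vgrproj (v : vert E) : grproj L :=
  GrProj (vgrmod_fg v) (@vgrmod_proj v).

Lemma vgrproj_gbasis (v : vert E) :
  gbasis (fun _ : 'I_1 => v) 0 (fun=> vmod_of v 1 : vgrproj v).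
Proof.
split=> [_|_|x|c].
- by rewrite /= /vmod_comp /= mulr1; apply: lv_comp.
- by apply: vmod_inj; rewrite vmod_ract /= mulr1 lv_idem.
- by exists (fun=> vmod_val x : L); rewrite big_ord1; apply: vmod_genE.
- rewrite big_ord1 => /(congr1 (fun x : vmod v => vmod_val x : L)).
  by rewrite vmod_ract /= mulr1 => c0 i; rewrite ord1.
Qed.

Lemma gzero_gbasis (vs : 'I_0 -> vert E) d : gbasis vs d (fun=> 0 : gzero L).
Proof.
split=> [[]|[]|x|c _ []] //; exists (fun=> 0); rewrite big_ord0; exact: thinmx0.
Qed.

Lemma dsum_ract (P Q : grproj L) (x : P) (y : Q) (r : L) :
  ((x, y) : dsum P Q) *> r = (x *> r, y *> r).
Proof. by []. Qed.

Lemma dsum_add (P Q : grproj L) (x x' : P) (y y' : Q) :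
  ((x, y) : dsum P Q) + ((x', y') : dsum P Q) = (x + x', y + y').
Proof. by []. Qed.

Lemma dsum_gbasis n (P Q : grproj L) (vs : 'I_n.+1 -> vert E) d
    (p : 'I_1 -> P) (q : 'I_n -> Q) :
  gbasis (fun _ : 'I_1 => vs ord0) d p ->
  gbasis (vs \o lift ord0) d q ->
  gbasis vs d
    (fun i => if unlift ord0 i is Some j then (0, q j) : dsum P Q
              else (p ord0, 0) : dsum P Q).
Proof.
move=> bp bq; set pq := (fun i => _).
have pq0 : pq ord0 = (p ord0, 0) by rewrite /pq unlift_none.
have pqS j : pq (lift ord0 j) = (0, q j) by rewrite /pq liftK.
have pqE (c : 'I_n.+1 -> L) : \sum_i pq i *> c i =
    (p ord0 *> c ord0, \sum_i q i *> c (lift ord0 i)).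
  rewrite big_ord_recl pq0; under eq_bigr => i _ do rewrite pqS.
  have -> : \sum_(i < n) (((0, q i) : dsum P Q) *> c (lift ord0 i)) =
      (0, \sum_i q i *> c (lift ord0 i)).
    elim/big_rec2: _ => // i x y _ ->.
    by rewrite dsum_ract dsum_add ract0l add0r.
  by rewrite dsum_ract dsum_add ract0l addr0 add0r.
split=> [i|i|[x y]|c].
- case: (unliftP ord0 i) => [j|] ->; rewrite ?pq0 ?pqS; split=> /=;
    by [apply: grading0 (gcomp_grading _) _|apply: gb_comp bq _|apply: gb_comp bp _].
- case: (unliftP ord0 i) => [j|] ->; rewrite ?pq0 ?pqS.
    by rewrite dsum_ract ract0l (gb_vert bq j).
  by rewrite dsum_ract ract0l (gb_vert bp ord0).
- have [a ->] := gb_span bp x; have [b ->] := gb_span bq y; rewrite big_ord1.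
  exists (fun i => if unlift ord0 i is Some j then b j else a ord0).
  rewrite pqE unlift_none; congr (_, _).
  by apply: eq_bigr => i _; rewrite liftK.
- rewrite pqE => -[c0 cS] i; case: (unliftP ord0 i) => [j|] ->.
    exact: (gb_free bq (c := fun j => c (lift ord0 j)) cS).
  by apply: (gb_free bp (c := fun=> c ord0) _ ord0); rewrite big_ord1.
Qed.

(** A model with prescribed vertices and known class, the direct sum of the [vgrproj (vs i)].
    Through [gb_iso] it determines the class of every module with such a basis. *)
Lemma std_exists (I : finType) (vs : I -> vert E) :
  exists (P : grproj L) (p : I -> P), gbasis vs 0 p /\
    vclass P = \sum_i vclass (vgrproj (vs i)).
Proof.
have ord n' (ws : 'I_n' -> vert E) : exists (P : grproj L) (p : 'I_n' -> P),
    gbasis ws 0 p /\ vclass P = \sum_i vclass (vgrproj (ws i)).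
  elim: n' ws => [|m IH] ws.
    by exists (gzero L), (fun=> 0); rewrite big_ord0; split=> //; apply: gzero_gbasis.
  have [P [p [bp cP]]] := IH (ws \o lift ord0).
  exists (dsum (vgrproj (ws ord0)) P); eexists; split.
    exact: dsum_gbasis (vgrproj_gbasis (ws ord0)) bp.
  by rewrite -vclass_dsum big_ord_recl -cP.
have [P [p [bp cP]]] := ord #|I| (fun i => vs (enum_val i)).
exists P, (p \o enum_rank); split.
  have := gb_reindex (h := enum_rank) (@enum_rank_bij I) bp.
  suff -> : (fun i => vs (enum_val i)) \o enum_rank = vs by [].
  by apply/funext => i /=; rewrite enum_rankK.
by rewrite cP -(big_enum_val (A := I) (fun i => vclass (vgrproj (vs i)))).
Qed.

(** The sign comes from P(j)_i = P_{i+j}: an element of degree [d] in [P] has degree [d - j] in the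
    shift. *)
Lemma gshift_gbasis (P : grproj L) (I : finType) (vs : I -> vert E) d
    (p : I -> P) j :
  gbasis vs d p -> gbasis vs (d - j) (p : I -> gshift j P).
Proof.
case=> cp vp sp fp; split=> // i; rewrite /= /shift_comp subrK; exact: cp.
Qed.

(** The shift by [- d] of the degree 0 model has a basis in degree [d] at the same vertices, hence
    is isomorphic to [P]. *)
Lemma gbasis_vclass (P : grproj L) (I : finType) (vs : I -> vert E) d (p : I -> P) :
  gbasis vs d p -> vclass P = vshift (- d) (\sum_i vclass (vgrproj (vs i))).
Proof.
move=> bp; have [Q [q [bq <-]]] := std_exists vs.
rewrite vclass_gshift; apply/vclassP.
have := gshift_gbasis (- d) bq; rewrite sub0r opprK; exact: gb_iso bp.
Qed.

End VertexProjective.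

(** * Refinement of a basis along the edges *)

Section Refinement.
Variables (K : fieldType) (E : digraph).
Hypothesis hE : no_sinks E.
Local Notation L := (leavitt_gr K E).
Local Notation lv := (lv K).
Local Notation le := (le K).
Local Notation lg := (lg K).
Local Notation A := (adjmx E).

Definition mult (I : finType) (vs : I -> vert E) : 'rV[nat]_#|vert E| :=
  \row_j \sum_i (vs i == enum_val j : nat).

Lemma mult_adjmx (I : finType) (vs : I -> vert E) (B : 'M[nat]_#|vert E|) j :
  (mult vs *m B) 0 j = \sum_i B (enum_rank (vs i)) j.
Proof.
rewrite mxE; under eq_bigr => k _ do rewrite mxE mulr_suml.
rewrite exchange_big; apply: eq_bigr => i _ /=.
rewrite (bigD1 (enum_rank (vs i))) //= enum_rankK eqxx mul1r big1 ?addr0 // => k.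
by case: (vs i =P enum_val k) => [->|//]; rewrite enum_valK eqxx.
Qed.

Lemma adjmxE i j : A i j =
  \sum_(a | src a == enum_val i) (rng a == enum_val j : nat).
Proof.
rewrite mxE -sum1_card -[RHS]/(\sum_(a | src a == enum_val i) _)%N.
rewrite [RHS]big_mkcond /= [LHS]big_mkcond /=; apply: eq_bigr => a _.
by rewrite inE; case: eqP; case: eqP.
Qed.

Section Kspan.
Variables (P : grmod L) (I : finType) (p : I -> P).

Definition kspan (x : P) : Prop :=
  exists k : I -> K, x = \sum_i p i *> lsc E (k i).

Lemma kspan0 : kspan 0.
Proof. by exists (fun=> 0); rewrite big1 // => i _; rewrite lsc0 ract0. Qed.

Lemma kspanD x y : kspan x -> kspan y -> kspan (x + y).
Proof.
move=> [k ->] [l ->]; exists (fun i => k i + l i); rewrite -big_split /=.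
by apply: eq_bigr => i _; rewrite lscD ractDr.
Qed.

Lemma kspanZ x k : kspan x -> kspan (x *> lsc E k).
Proof.
move=> [l ->]; exists (fun i => l i * k); rewrite ract_suml.
by apply: eq_bigr => i _; rewrite ractM lscM.
Qed.

Lemma kspan_in i : kspan (p i).
Proof.
exists (fun j => if j == i then 1 else 0).
rewrite (bigD1 i) //= eqxx lsc1 ract1 big1 ?addr0 // => j /negPf ->.
by rewrite lsc0 ract0.
Qed.

Lemma kspan_sum (J : finType) (F : J -> P) :
  (forall j, kspan (F j)) -> kspan (\sum_j F j).
Proof. by move=> kF; elim/big_ind: _ => //; [apply: kspan0|apply: kspanD]. Qed.

(** Right multiplication by [v] fixes [x] and kills the [p i] at other vertices, so their
    coefficients can be replaced by zero. *)
Lemma kspan_vert (vs : I -> vert E) x v :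
  (forall i, p i *> lv (vs i) = p i) -> x *> lv v = x -> kspan x ->
  exists2 k : I -> K, (forall i, vs i != v -> k i = 0) &
    x = \sum_i p i *> lsc E (k i).
Proof.
move=> vp vx [k xE]; exists (fun i => if vs i == v then k i else 0).
  by move=> i /negPf ->.
rewrite -vx {1}xE ract_suml; apply: eq_bigr => i _.
rewrite ractM lscC -ractM -{1}vp [_ *> lv v]ractM lv_lv.
by case: eqP => _; rewrite ?vp // ract0 ract0l lsc0 ract0.
Qed.

End Kspan.

Section OneStep.
Variables (P : grmod L) (I : finType) (vs : I -> vert E) (d : int) (p : I -> P).
Hypothesis bp : gbasis vs d p.

Definition out_pred : {pred I * edge E} := fun x => src x.2 == vs x.1.
Local Notation I' := {x in out_pred}.

Definition out_vert (y : I') : vert E := rng (val y).2.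
Definition out_elt (y : I') : P := p (val y).1 *> le (val y).2.

Lemma sum_out (V : nmodType) (F : I -> edge E -> V) :
  \sum_i \sum_(a | src a == vs i) F i a = \sum_(y : I') F (val y).1 (val y).2.
Proof.
rewrite pair_big_dep /=.
exact: (big_sub out_pred (fun x : I * edge E => F x.1 x.2)).
Qed.

(** Spanning comes from v = sum of a a^* over the edges leaving [v]; freeness from multiplying a
    relation by a ghost edge, which isolates one coefficient. *)
Lemma out_gbasis : gbasis out_vert (d + 1) out_elt.
Proof.
split=> [y|y|x|c].
- by apply: gcompZ; [apply: gb_comp bp _|apply: le_comp].
- by rewrite ractM le_lv eqxx.
- have [c ->] := gb_span bp x; exists (fun y => lg (val y).2 * c (val y).1).
  under [RHS]eq_bigr => y _ do rewrite ractM.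
  rewrite -(sum_out (fun i a => p i *> (le a * (lg a * c i)))).
  apply: eq_bigr => i _; rewrite -{1}(gb_vert bp i) ractM -ract_sumr.
  congr (_ *> _); rewrite -CK2_sum ?mulr_suml //.
  by apply: eq_bigr => a _; rewrite mulrA.
- move=> c0 y.
  (* The coefficients are extended by zero to all pairs, so that the sum over [I'] becomes an
     iterated sum over [I] and the edges. *)
  pose c' i a : L := if insub (i, a) is Some z then c z else 0.
  have c'E z : c' (val z).1 (val z).2 = c z by rewrite /c' -surjective_pairing valK.
  have : \sum_i p i *> (\sum_(a | src a == vs i) le a * c' i a) = 0.
    rewrite -[RHS]c0; under [RHS]eq_bigr => z _ do rewrite -c'E ractM.
    rewrite -(sum_out (fun i a => p i *> (le a * c' i a))).
    by apply: eq_bigr => i _; rewrite ract_sumr.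
  move=> /(gb_free bp)/(_ (val y).1)/(congr1 (fun z => lg (val y).2 * z)).
  have /eqP sy : src (val y).2 == vs (val y).1 by exact: valP y.
  rewrite mulr0 mulrA lg_lv sy eqxx mulr_sumr.
  rewrite (bigD1 (val y).2) ?sy //= mulrA lg_le eqxx c'E big1 ?addr0 // => a /andP[_ ne].
  by rewrite mulrA lg_le eq_sym (negPf ne) mul0r.
Qed.

Lemma mult_out : mult out_vert = mult vs *m A.
Proof.
apply/rowP => j; rewrite mult_adjmx mxE.
rewrite -(sum_out (fun i a => rng a == enum_val j : nat)).
by apply: eq_bigr => i _; rewrite adjmxE enum_rankK.
Qed.

Lemma out_eltE i a : exists o : option I',
  p i *> le a = if o is Some y then out_elt y else 0.
Proof.
have [e|ne] := boolP ((i, a) \in out_pred).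
  by exists (Some (exist _ (i, a) e)).
exists None; rewrite -(gb_vert bp) ractM lv_le eq_sym; case: ifP => ia.
  by rewrite -[_ \in _]/(src a == vs i) ia in ne.
exact: ract0.
Qed.

End OneStep.

(** The refined basis is kept only through what is used of it: its elements are products of a [p i]
    with a combination of paths of length [n], and all such products lie in its [K]-span. Spans over
    [K] can thus be compared by path length. *)
Lemma refine n (P : grmod L) (I : finType) (vs : I -> vert E) d (p : I -> P) :
  gbasis vs d p -> exists (I' : finType) (vs' : I' -> vert E) (p' : I' -> P),
  [/\ gbasis vs' (d + n%:Z) p',
      forall i', exists i y, lpath n y /\ p' i' = p i *> y,
      forall i y, lpath n y -> kspan p' (p i *> y)
    & mult vs' = mult vs *m A ^+ n].
Proof.
elim: n I vs d p => [|n IH] I vs d p bp.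
  exists I, vs, p; split; rewrite ?addr0 ?expr0 ?mulmx1 //.
    move=> i; exists i, (lv (vs i)); split; first exact: lp_vert.
    by rewrite (gb_vert bp).
  move=> i y; move e: 0%N => m py; elim: py e => {m y}.
  - move=> v _; rewrite -(gb_vert bp) ractM lv_lv; case: ifP => _.
      by rewrite (gb_vert bp); apply: kspan_in.
    by rewrite ract0; apply: kspan0.
  - by move=> m _; rewrite ract0; apply: kspan0.
  - by move=> m x y _ IHx _ IHy e; rewrite ractDr; apply: kspanD; auto.
  - by move=> m x k _ IHx e; rewrite -ractM; apply: kspanZ; auto.
  - by [].
have [I' [vs' [p' [bp' pE' pk' mE']]]] := IH _ _ _ _ (out_gbasis bp).
exists I', vs', p'; split.
- by rewrite -[n.+1]add1n PoszD addrA.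
- move=> i'; have [i [y [py ->]]] := pE' i'; exists (val i).1, (le (val i).2 * y).
  by split; [apply: lp_edge|rewrite -ractM].
- move=> i y; move e: n.+1 => m py; elim: py e => {m y}.
  + by [].
  + by move=> m _; rewrite ract0; apply: kspan0.
  + by move=> m x y _ IHx _ IHy e; rewrite ractDr; apply: kspanD; auto.
  + by move=> m x k _ IHx e; rewrite -ractM; apply: kspanZ; auto.
  + move=> m a x px _ [e]; rewrite -e in px; rewrite -ractM.
    have [[z|] ->] := out_eltE bp i a; first exact: pk'.
    by rewrite ract0l; apply: kspan0.
- by rewrite mE' mult_out -mulmxA exprS.
Qed.

End Refinement.

(** * Comparison of two bases of one module *)

Section Comparison.
Variables (K : fieldType) (E : digraph).
Hypothesis hE : no_sinks E.
Local Notation L := (leavitt_gr K E).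
Local Notation lv := (lv K).
Local Notation A := (adjmx E).

Lemma kspan_free (P : grmod L) (I : finType) (vs : I -> vert E) d (p : I -> P)
    (k : I -> K) :
  gbasis vs d p -> \sum_i p i *> lsc E (k i) = 0 -> forall i, k i = 0.
Proof.
move=> bp /(gb_free bp) + i => /(_ i); rewrite -lscC; exact: lsc_lv_eq0.
Qed.

(** The transition matrices satisfy X Y = 1 by freeness over [K], and their entries vanish between
    different vertices. Hence the blocks at [v] also have product 1, which bounds the size of one by
    that of the other. *)
Lemma kspan_leq_card (P : grmod L) (I J : finType) (vs : I -> vert E)
    (ws : J -> vert E) d d' (p : I -> P) (q : J -> P) v :
  gbasis vs d p -> gbasis ws d' q ->
  (forall i, kspan q (p i)) -> (forall j, kspan p (q j)) ->
  (#|[set i | vs i == v]| <= #|[set j | ws j == v]|)%N.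
Proof.
move=> bp bq kp kq.
have /choice[X XP] i : exists k : J -> K, (forall j, ws j != vs i -> k j = 0) /\
    p i = \sum_j q j *> lsc E (k j).
  by have [k] := kspan_vert (gb_vert bq) (gb_vert bp i) (kp i); exists k.
have /choice[Y YP] j : exists k : I -> K, (forall i, vs i != ws j -> k i = 0) /\
    q j = \sum_i p i *> lsc E (k i).
  by have [k] := kspan_vert (gb_vert bp) (gb_vert bq j) (kq j); exists k.
have XY i i' : \sum_j X i j * Y j i' = (i == i')%:R.
  apply/eqP; rewrite -subr_eq0; apply/eqP; move: i'.
  apply: (kspan_free (k := fun i' => \sum_j X i j * Y j i' - (i == i')%:R) bp).
  under eq_bigr => i' _ do rewrite lscD ractDr.
  rewrite big_split /= [X in _ + X](bigD1 i) //= eqxx [X in _ + (_ + X)]big1.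
    rewrite addr0; have -> : lsc E (- 1) = - 1 :> L by rewrite /lsc scaleN1r.
    rewrite -[- 1]add0r ractBr ract0 add0r ract1.
    rewrite [X in _ - X](XP i).2; apply/eqP; rewrite subr_eq0; apply/eqP.
    under [RHS]eq_bigr => j _ do rewrite (YP j).2 ract_suml.
    rewrite exchange_big; apply: eq_bigr => i' _ /=; rewrite lsc_sum ract_sumr.
    by apply: eq_bigr => j _; rewrite ractM lscM mulrC.
  by move=> i' /negPf; rewrite eq_sym => ->; rewrite oppr0 lsc0 ract0.
pose S := [set i | vs i == v]; pose T := [set j | ws j == v].
pose MX := \matrix_(i < #|S|, j < #|T|) X (enum_val i) (enum_val j).
pose MY := \matrix_(j < #|T|, i < #|S|) Y (enum_val j) (enum_val i).
apply: (@mulmx1_min _ _ _ MX MY); apply/matrixP => i i'; rewrite !mxE.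
under eq_bigr => j _ do rewrite !mxE.
rewrite -(big_enum_val (fun j => X (enum_val i) j * Y j (enum_val i'))).
have := XY (enum_val i) (enum_val i'); rewrite (inj_eq enum_val_inj) => <-.
rewrite [RHS](bigID [in T]) /= [X in _ + X]big1 ?addr0 // => j jT.
rewrite (XP _).1 ?mul0r //; have := enum_valP i; rewrite !inE => /eqP ->.
by rewrite inE in jT.
Qed.

Lemma mult_card (I : finType) (vs : I -> vert E) j :
  mult vs 0 j = #|[set i | vs i == enum_val j]|.
Proof.
rewrite mxE -sum1_card [RHS]big_mkcond /=; apply: eq_bigr => i _.
by rewrite inE; case: eqP.
Qed.

Lemma lpath_stable (T : finType) (F : T -> L) :
  (forall t, gring_comp 0 (F t)) -> exists k : nat, forall n, (k <= n)%N ->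
  forall t y, lpath n y -> lpath n (F t * y).
Proof.
move=> cF; have /choice[k kP] t : exists k : nat, forall n, (k <= n)%N ->
    forall y, lpath n y -> lpath n (F t * y).
  have [k kP] := comp_mul_lpath (cF t); exists k => n /kP[m e].
  by have -> : m = n by apply/eqP; rewrite -eqz_nat e addr0.
exists (\max_t k t) => n kn t; apply: kP; apply: leq_trans kn; exact: leq_bigmax.
Qed.

(** The coefficients of the [z t] in the basis have degree 0 and are finite in number. For large [n]
    they all preserve the span of the paths of length [n]. *)
Lemma refine_kspan (P : grmod L) (I T : finType) (vs : I -> vert E) d (p : I -> P)
    (z : T -> P) :
  gbasis vs d p -> (forall t, gcomp d (z t)) ->
  exists k : nat, forall n, (k <= n)%N ->
  forall (I' : finType) (p' : I' -> P),
    (forall i y, lpath n y -> kspan p' (p i *> y)) ->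
    forall t y, lpath n y -> kspan p' (z t *> y).
Proof.
move=> bp cz.
have /choice[x xP] t : exists x : I -> L, (forall i, gring_comp 0 (x i)) /\
    z t = \sum_i p i *> x i.
  by have [x cx e] := gb_spanh bp (cz t); exists x; rewrite subrr in cx.
have [] := @lpath_stable (T * I)%type (fun ti => x ti.1 ti.2).
  by move=> ti; apply: (xP _).1.
move=> k kP; exists k => n kn I' p' kp' t y py.
rewrite (xP t).2 ract_suml; apply: kspan_sum => i; rewrite ractM.
by apply/kp'/(kP _ kn (t, i)).
Qed.

(** Refined often enough, each basis lies in the [K]-span of the other, so both have equally many
    elements at each vertex. *)
Lemma gbasis_mult (P : grmod L) (I J : finType) (vs : I -> vert E)
    (ws : J -> vert E) d (p : I -> P) (q : J -> P) :
  gbasis vs d p -> gbasis ws d q ->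
  exists n, mult vs *m A ^+ n = mult ws *m A ^+ n.
Proof.
move=> bp bq.
have [k kP] := refine_kspan bp (gb_comp bq); have [l lP] := refine_kspan bq (gb_comp bp).
exists (maxn k l); set n := maxn k l.
have [I' [vs' [p' [bp' pE pk <-]]]] := refine hE n bp.
have [J' [ws' [q' [bq' qE qk <-]]]] := refine hE n bq.
have pq i : kspan q' (p' i).
  by have [j [y [py ->]]] := pE i; apply: lP qk _ _ py; apply: leq_maxr.
have qp j : kspan p' (q' j).
  by have [i [y [py ->]]] := qE j; apply: kP pk _ _ py; apply: leq_maxl.
apply/rowP => v; rewrite !mult_card; apply/eqP; rewrite eqn_leq.
by rewrite (kspan_leq_card _ bp' bq') ?(kspan_leq_card _ bq' bp').
Qed.

End Comparison.

(** * Generated submodules and graded sections *)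

Inductive rgen (R : pzRingType) (M : lmodType (op_ring R)) (S : M -> Prop) : M -> Prop :=
  | rg_in x : S x -> rgen S x
  | rg_zero : rgen S 0
  | rg_add x y : rgen S x -> rgen S y -> rgen S (x + y)
  | rg_act x r : rgen S x -> rgen S (x *> r).

Lemma rgen_trans (R : pzRingType) (M : lmodType (op_ring R)) (S T : M -> Prop) x :
  (forall y, S y -> rgen T y) -> rgen S x -> rgen T x.
Proof.
move=> ST; elim=> {x} [x /ST //||x y _ rx _ ry|x r _ rx].
- exact: rg_zero.
- exact: rg_add.
- exact: rg_act.
Qed.

Lemma rgen_sum (R : pzRingType) (M : lmodType (op_ring R)) (S : M -> Prop)
    (J : eqType) (s : seq J) (F : J -> M) :
  (forall j, j \in s -> rgen S (F j)) -> rgen S (\sum_(j <- s) F j).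
Proof.
move=> rF; rewrite big_seq; elim/big_ind: _ => //; first exact: rg_zero.
exact: rg_add.
Qed.

Lemma rgen_family (R : pzRingType) (M : lmodType (op_ring R)) (I : finType)
    (g : I -> M) x :
  rgen (fun y => exists i, y = g i) x -> exists c : I -> R, x = \sum_i g i *> c i.
Proof.
elim=> {x} [_ [i ->]||x y _ [c ->] _ [d ->]|x r _ [c ->]].
- exists (fun j => if j == i then 1 else 0).
  rewrite (bigD1 i) //= eqxx ract1 big1 ?addr0 // => j /negPf ->.
  by rewrite ract0.
- by exists (fun=> 0); rewrite big1 // => i _; rewrite ract0.
- exists (fun i => c i + d i); rewrite -big_split /=.
  by apply: eq_bigr => i _; rewrite ractDr.
- exists (fun i => c i * r); rewrite ract_suml.
  by apply: eq_bigr => i _; rewrite ractM.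
Qed.

Lemma linear_gpr (R : gradedRing) (M N : grmod R) (f : {linear M -> N}) i x :
  (forall j y, gcomp j y -> gcomp j (f y)) ->
  f (gpr (gcomp_grading M) i x) = gpr (gcomp_grading N) i (f x).
Proof.
move=> cf; elim/(gr_ind (gcomp_grading M)): x => [x y IHx IHy||j x cx].
- by rewrite gprD !raddfD /= gprD IHx IHy.
- by rewrite gpr0 !raddf0 gpr0.
- rewrite (gpr_id _ _ cx) (gpr_id _ _ (cf _ _ cx)); case: eqP => // _.
  exact: raddf0.
Qed.

(** Projectivity of the ungraded module yields only an ungraded section [h]. Its degree zero part is
    still a section because [f] commutes with the homogeneous projections. *)
Lemma graded_section (R : gradedRing) (M N : grmod R) (f : {linear M -> N})
    (h : {linear N -> M}) :
  (forall j y, gcomp j y -> gcomp j (f y)) -> (forall x, f (h x) = x) ->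
  exists h0 : {linear N -> M}, (forall j y, gcomp j y -> gcomp j (h0 y)) /\
    (forall x, f (h0 x) = x).
Proof.
move=> cf fh.
pose gM := gcomp_grading M; pose gN := gcomp_grading N.
pose h0 := degree0_part gN (gpr gM) h.
have h0E s : (forall p, p \in s -> gcomp p.1 p.2) ->
    h0 (\sum_(p <- s) p.2) = \sum_(p <- s) gpr gM p.1 (h p.2).
  by apply: degree0_partE; [apply: raddfD|move=> i x y; apply: gprD].
have h0h j x : gcomp j x -> h0 x = gpr gM j (h x).
  move=> cx; have := h0E [:: (j, x)]; rewrite !big_seq1; apply=> p.
  by rewrite inE => /eqP ->.
have h0D x y : h0 (x + y) = h0 x + h0 y.
  rewrite {1}(gr_seq_sum gN x) {1}(gr_seq_sum gN y) -big_cat h0E ?big_cat //.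
  by move=> p; rewrite mem_cat => /orP[] /gr_seq_comp.
have h00 : h0 0 = 0 by apply: (addrI (h0 0)); rewrite -h0D !addr0.
(* By additivity both [x] and [r] may be taken homogeneous. *)
have h0Z x (r : R) : h0 (x *> r) = h0 x *> r.
  elim/(gr_ind gN): x => [x y IHx IHy||i x cx].
  - by rewrite ractDl !h0D IHx IHy ractDl.
  - by rewrite ract0l !h00 ract0l.
  elim/(gr_ind (gring_grading R)): r => [r s IHr IHs||k r cr].
  - by rewrite !ractDr h0D IHr IHs.
  - by rewrite !ract0 h00.
  rewrite (h0h (i + k)); last exact: gcompZ.
  by rewrite (h0h i) // linear_ract gpr_ractl.
have lh : linear h0 by move=> r x y; rewrite h0D; congr (_ + _); apply: h0Z.
exists (linear_pack lh); split=> [j x cx|x] /=.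
  by rewrite (h0h j) //; apply: gpr_comp.
elim/(gr_ind gN): x => [x y IHx IHy||i x cx].
- by rewrite h0D raddfD /= IHx IHy.
- by rewrite h00 raddf0.
- by rewrite (h0h i) // linear_gpr // fh (gpr_id _ _ cx) eqxx.
Qed.

(** * Every graded finitely generated projective module has a basis *)

Section Structure.
Variables (K : fieldType) (E : digraph).
Hypothesis hE : no_sinks E.
Local Notation L := (leavitt_gr K E).
Local Notation lv := (lv K).

Section Generators.
Variable P : grmod L.

Definition typed (d : int) (w : vert E * P) : Prop :=
  gcomp d w.2 /\ w.2 *> lv w.1 = w.2.

Definition gen_by (s : seq (vert E * P)) : P -> Prop :=
  rgen (fun y => exists2 w, w \in s & y = w.2).

(* Since 1 is the sum of the a a^*, an element x of degree i is generated by
   the elements x a of degree i + 1. *)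
Lemma gen_raise i n (x : P) : gcomp i x -> exists2 s : seq (vert E * P),
  (forall w, w \in s -> typed (i + n%:Z) w) & gen_by s x.
Proof.
move=> cx; elim: n => [|n [s ts xs]].
  exists [seq (v, x *> lv v) | v <- enum (vert E)].
    move=> _ /mapP[v _ ->]; split; last by rewrite ractM lv_idem.
    by apply: gcompZ => //; apply: lv_comp.
  set s := [seq _ | v <- _].
  rewrite -[x]ract1 -(sum_lv K E) ract_sumr -big_enum.
  apply: rgen_sum => v ve; apply: rg_in; exists (v, x *> lv v) => //.
  by apply/mapP; exists v; rewrite ?mem_enum.
exists [seq (rng a, w.2 *> le K a) | w <- s, a <- enum (edge E)].
  move=> _ /allpairsP[[w a] /= [ws _ ->]]; have [cw _] := ts _ ws.
  split=> /=; last by rewrite ractM le_lv eqxx.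
  by rewrite -addn1 PoszD addrA; apply: gcompZ => //; apply: le_comp.
apply: rgen_trans xs => _ [w ws ->].
rewrite -[w.2]ract1 -(sum_le_lg K hE) ract_sumr -big_enum.
apply: rgen_sum => a ae; rewrite -ractM; apply/rg_act/rg_in.
exists (rng a, w.2 *> le K a) => //.
by apply/allpairsP; exists (w, a); rewrite /= ws mem_enum.
Qed.

Lemma gen_same_degree (D : int) (t : seq (int * P)) :
  (forall p, p \in t -> gcomp p.1 p.2 /\ p.1 <= D) ->
  exists2 s : seq (vert E * P), (forall w, w \in s -> typed D w) &
    forall p, p \in t -> gen_by s p.2.
Proof.
elim: t => [|p t IH] ct; first by exists [::].
have [p' p't|s ts gs] := IH; first by apply: ct; rewrite inE p't orbT.
have [cp pD] := ct p (mem_head _ _).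
have [n nE] : exists n : nat, p.1 + n%:Z = D.
  have : 0 <= D - p.1 by rewrite subr_ge0.
  by case e: (D - p.1) => [n|//] _; exists n; rewrite -e addrC subrK.
have [r tr gr] := gen_raise n cp; rewrite nE in tr.
have mono (s1 s2 : seq (vert E * P)) x : {subset s1 <= s2} -> gen_by s1 x -> gen_by s2 x.
  by move=> s12; apply: rgen_trans => y [w /s12 ws ->]; apply: rg_in; exists w.
exists (r ++ s) => [w|q].
  by rewrite mem_cat => /orP[/tr|/ts].
rewrite inE => /orP[/eqP ->|qt].
  by apply: mono gr => w; rewrite mem_cat => ->.
by apply: mono (gs _ qt) => w; rewrite mem_cat orbC => ->.
Qed.

Lemma fg_typed_generators : fin_generated P ->
  exists (D n : nat) (vs : 'I_n -> vert E) (g : 'I_n -> P),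
  [/\ forall i, gcomp D%:Z (g i), forall i, g i *> lv (vs i) = g i &
      forall x, exists c : 'I_n -> L, x = \sum_i g i *> c i].
Proof.
move=> [m [g gP]]; have gC := gcomp_grading P.
pose t := flatten [seq gr_seq gC (g j) | j <- enum 'I_m].
(* A crude upper bound for all the degrees; being a natural number, it later serves as the exponent
   of a negative shift. *)
pose D := (\sum_(p <- t) absz p.1)%N.
have ct p : p \in t -> gcomp p.1 p.2 /\ p.1 <= D%:Z.
  move=> pt; split; first by move: pt => /flatten_mapP[j _]; apply: gr_seq_comp.
  apply: (le_trans (ler_norm _)); rewrite -abszE lez_nat /D (big_rem p) //=.
  exact: leq_addr.
have [s ts gs] := gen_same_degree ct.
exists D, (size s), (fun i => (tnth (in_tuple s) i).1),
  (fun i => (tnth (in_tuple s) i).2).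
have ti i := ts _ (mem_tnth i (in_tuple s)).
split=> [i|i|x]; [by have [] := ti i|by have [] := ti i|].
apply: rgen_family; have [c ->] := gP x; rewrite -big_enum.
apply: (@rgen_trans _ _ (fun y => exists2 w, w \in s & y = w.2)).
  move=> _ [w /(tnthP (in_tuple s))[i ->] ->]; apply: rg_in; by exists i.
apply: rgen_sum => j je; apply: rg_act; rewrite (gr_seq_sum gC (g j)).
apply: rgen_sum => p pj; apply: gs; apply/flatten_mapP; by exists j.
Qed.

End Generators.

Lemma gbasis_ord (P : grmod L) (I : finType) (vs : I -> vert E) d (p : I -> P) :
  gbasis vs d p -> gbasis (fun k : 'I_#|I| => vs (enum_val k)) d
                          (fun k => p (enum_val k)).
Proof. exact: gb_reindex (@enum_val_bij I). Qed.

(* By refining the basis e of a free cover N of P, the graded idempotent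
   N -> P -> N gets a matrix H over K; the images in P of the basis vectors
   labelled by a row basis of H form a basis of P. *)
Lemma gbasis_exists (P : grproj L) :
  exists (D n : nat) (vs : 'I_n -> vert E) (p : 'I_n -> P), gbasis vs D p.
Proof.
have [D [n [vs [g [cg vg gP]]]]] := fg_typed_generators (gproj_fg P).
have [N [e0 [be0 _]]] := std_exists K vs.
have [N' [e be]] : exists (N' : grproj L) (e : 'I_n -> N'), gbasis vs D e.
  have := gshift_gbasis (- D%:Z) be0; rewrite sub0r opprK => be.
  by exists (gshift (- D%:Z) N), e0.
have [f fe cf] := gb_lift be cg vg.
have fsurj y : exists x, f x = y.
  have [c ->] := gP y; exists (\sum_i e i *> c i); rewrite linear_ract_sum.
  by apply: eq_bigr => i _; rewrite fe.
have [h1 h1P] := gproj_proj (idfun : {linear P -> P}) fsurj.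
have [h [ch hP]] := graded_section cf h1P.
(* After [m] refinements of [e], the map [h] after [f] sends basis vectors to [K]-combinations of
   basis vectors. *)
have [m mP] := refine_kspan be (fun i => ch _ _ (cg i)).
have [I [us [e' [be' e'E ek _]]]] := refine hE m be.
pose q (k : 'I_#|I|) := e' (enum_val k); pose us' (k : 'I_#|I|) := us (enum_val k).
have bq : gbasis us' (D + m)%N%:Z q by exact: gbasis_ord be'.
have ek' y : kspan e' y -> kspan q y.
  move=> [k ->]; exists (fun i => k (enum_val i)).
  by rewrite (reindex (@enum_val I I)) //; apply/onW_bij/enum_val_bij.
have hq k : kspan q (h (f (q k))).
  apply: ek'; have [i [y [py qE]]] := e'E (enum_val k).
  rewrite /q qE linear_ract fe linear_ract; exact: mP (leqnn m) _ _ ek _ _ py.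
have vq k : h (f (q k)) *> lv (us' k) = h (f (q k)).
  by rewrite -!linear_ract (gb_vert bq).
have /choice[H0 H0P] k : exists c : 'I_#|I| -> K,
    (forall j, us' j != us' k -> c j = 0) /\
    h (f (q k)) = \sum_j q j *> lsc E (c j).
  by have [c] := kspan_vert (gb_vert bq) (vq k) (hq k); exists c.
pose H : 'M[K]_#|I| := \matrix_(i, j) H0 i j.
(* [F] selects rows of [H] that form a basis [B] of its row space. Then [W] writes all rows of [H]
   in terms of [B], and [V] is a right inverse of [B]. *)
pose F := maxrankfun H; pose B := rowsub F H.
have [W WE] : exists W, H = W *m B by apply/submxP; rewrite eq_maxrowsub.
have [V VE] : exists V, B *m V = 1%:M by apply/row_freeP; apply: maxrowsub_free.
(* The idempotency of [h] after [f] enters here, as [f (q k) = f (h (f (q k)))]. *)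
have fqE k : f (q k) = \sum_j f (q j) *> lsc E (H k j).
  rewrite -{1}[f (q k)]hP (H0P k).2 linear_ract_sum.
  by apply: eq_bigr => j _; rewrite mxE.
exists (D + m)%N, (\rank H), (us' \o F), (f \o q \o F); split.
- by move=> k; apply: cf; apply: gb_comp bq _.
- by move=> k; rewrite /= -linear_ract (gb_vert bq).
- move=> x; have [y <-] := fsurj x; have [c ->] := gb_span bq y.
  (* From [H = W *m B], each [f (q i)] is the combination of the [f (q (F k))] with coefficients
     [W i k]. *)
  exists (fun k => \sum_i lsc E (W i k) * c i).
  under [RHS]eq_bigr => k _ do rewrite ract_sumr.
  rewrite exchange_big linear_ract_sum; apply: eq_bigr => i _ /=.
  under [RHS]eq_bigr => k _ do rewrite -ractM.
  rewrite -ract_suml; congr (_ *> _); rewrite fqE.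
  under [RHS]eq_bigr => k _ do rewrite fqE ract_suml.
  rewrite exchange_big; apply: eq_bigr => j _ /=.
  under [RHS]eq_bigr => k _ do rewrite ractM lscM.
  rewrite -ract_sumr -lsc_sum {1}WE mxE; congr (_ *> lsc E _).
  by apply: eq_bigr => k _; rewrite !mxE mulrC.
move=> c c0 k.
(* Applying [h] and the freeness of [q] gives this with [us' j] in place of [us' (F k)]; where these
   vertices differ, the entry [B k j] is zero. *)
have Hc j : \sum_k lsc E (B k j) * (lv (us' (F k)) * c k) = 0.
  have : \sum_j q j *> (\sum_k lsc E (B k j) * c k) = 0.
    under eq_bigr => i _ do rewrite ract_sumr.
    have hc0 := congr1 h c0; rewrite linear_ract_sum raddf0 in hc0.
    rewrite exchange_big -[RHS]hc0; apply: eq_bigr => i _ /=.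
    rewrite (H0P _).2 ract_suml; apply: eq_bigr => l _.
    by rewrite ractM !mxE.
  move=> /(gb_free bq) /(_ j); rewrite mulr_sumr => Hj0.
  rewrite -[RHS]Hj0; apply: eq_bigr => i _.
  rewrite [RHS]mulrA -lscC -mulrA !mxE.
  case: (us' j =P us' (F i)) => [-> //|/eqP ne].
  by rewrite (H0P _).1 // lsc0 !mul0r.
(* Contraction with the right inverse [V] of [B] isolates the coefficient of index [k]. *)
transitivity (\sum_j lsc E (V j k) * (\sum_i lsc E (B i j) * (lv (us' (F i)) * c i)));
  last by rewrite big1 // => j _; rewrite Hc mulr0.
under eq_bigr => j _ do rewrite mulr_sumr.
rewrite exchange_big /=.
have BV i : \sum_j lsc E (V j k) * lsc E (B i j) = lsc E ((i == k)%:R : K) :> L.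
  have := congr1 (fun M : 'M_(\rank H) => M i k) VE; rewrite !mxE => <-.
  by rewrite lsc_sum; apply: eq_bigr => j _; rewrite lscM mulrC.
under eq_bigr => i _.
  under eq_bigr => j _ do rewrite mulrA.
  rewrite -mulr_suml BV lsc_nat; over.
rewrite (bigD1 k) //= eqxx mul1r big1 ?addr0 // => i /negPf ->.
by rewrite mul0r.
Qed.

End Structure.

(** * Dimension modules of nonnegative integer matrices *)

(* V, with the shift T and the positive cone pos, is the direct limit of
   Z^n -> Z^n -> ... (row vectors multiplied by A) ordered by the images of N^n;
   phi is the canonical map from the first copy of N^n, and T is induced by A. *)
Record dimension_module (V : zmodType) (T : int -> V -> V) (pos : V -> Prop)
    (n : nat) (A : 'M[nat]_n) (phi : 'rV[nat]_n -> V) : Prop := DimensionModule {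
  dm_T0 : T 0 =1 id;
  dm_TA : forall i j x, T (i + j) x = T i (T j x);
  dm_TD : forall i, {morph T i : x y / x + y};
  dm_phiD : {morph phi : a b / a + b};
  dm_T1 : forall a, T 1 (phi a) = phi (a *m A);
  dm_eq : forall a b, phi a = phi b -> exists k, a *m A ^+ k = b *m A ^+ k;
  dm_pos : forall x, pos x <-> exists (k : nat) a, x = T (- k%:Z) (phi a);
  dm_diff : forall x, exists y z, [/\ pos y, pos z & x = y - z] }.

Lemma intertwine_exp m n (A : 'M[nat]_m) (B : 'M[nat]_n) (R : 'M[nat]_(m, n)) k :
  A *m R = R *m B -> A ^+ k *m R = R *m B ^+ k.
Proof.
move=> AR; elim: k => [|k IH]; first by rewrite !expr0 mul1mx mulmx1.
by rewrite !exprS -mulmxA IH mulmxA AR -mulmxA.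
Qed.

Lemma additive_rV_nat (W : nmodType) n (f g : 'rV[nat]_n -> W) :
  f 0 = 0 -> g 0 = 0 ->
  {morph f : a b / a + b} -> {morph g : a b / a + b} ->
  (forall j, f (delta_mx 0 j) = g (delta_mx 0 j)) -> f =1 g.
Proof.
move=> f0 g0 fD gD fg a.
have Mn (h : 'rV[nat]_n -> W) : h 0 = 0 -> {morph h : a b / a + b} ->
    forall k b, h (b *+ k) = h b *+ k.
  move=> h0 hD; elim=> [|k IH] b; first by rewrite !mulr0n.
  by rewrite !mulrS hD IH.
have -> : a = \sum_j delta_mx 0 j *+ a 0 j.
  apply/rowP => i; rewrite summxE (bigD1 i) //= big1 => [|j /negPf ji].
    by rewrite mulmxnE mxE !eqxx addr0 /=; apply/esym/natn.
  by rewrite [LHS]mulmxnE mxE [i == j]eq_sym ji andbF mul0rn.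
rewrite (big_morph f fD f0) (big_morph g gD g0); apply: eq_bigr => j _.
by rewrite !Mn // fg.
Qed.

Section DimensionModule.
Variables (V : zmodType) (T : int -> V -> V) (pos : V -> Prop).
Variables (n : nat) (A : 'M[nat]_n) (phi : 'rV[nat]_n -> V).
Hypothesis dV : dimension_module T pos A phi.

Lemma dm_TK i : cancel (T i) (T (- i)).
Proof. by move=> x; rewrite -(dm_TA dV) addNr (dm_T0 dV). Qed.

Lemma dm_TNK i : cancel (T (- i)) (T i).
Proof. by move=> x; rewrite -(dm_TA dV) addrN (dm_T0 dV). Qed.

Lemma dm_phi0 : phi 0 = 0.
Proof. by apply: (addrI (phi 0)); rewrite -(dm_phiD dV) !addr0. Qed.

Lemma dm_TX (k : nat) a : T k (phi a) = phi (a *m A ^+ k).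
Proof.
elim: k => [|k IH]; first by rewrite (dm_T0 dV) expr0 mulmx1.
by rewrite -add1n PoszD (dm_TA dV) IH (dm_T1 dV) -mulmxA exprSr.
Qed.

Lemma dm_phi_pos a : pos (phi a).
Proof. by apply/(dm_pos dV); exists 0%N, a; rewrite oppr0 (dm_T0 dV). Qed.

Lemma dm_T_pos i x : pos x -> pos (T i x).
Proof.
move=> /(dm_pos dV)[k [a ->]]; apply/(dm_pos dV).
rewrite -(dm_TA dV); case: i => m; last first.
  by exists (m.+1 + k)%N, a; rewrite NegzE PoszD opprD.
by exists k, (a *m A ^+ m); rewrite -dm_TX -(dm_TA dV) addrC.
Qed.

(** The two positive parts of [x] are brought to a common shift. *)
Lemma dm_rep x : exists (k : nat) a b, T k x + phi b = phi a.
Proof.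
have [_ [_ [/(dm_pos dV)[k [a ->]] /(dm_pos dV)[l [b ->]] ->]]] := dm_diff dV x.
exists (k + l)%N, (a *m A ^+ l), (b *m A ^+ k).
rewrite -!dm_TX.
have -> : T l (phi a) = T (k + l)%N (T (- k%:Z) (phi a)).
  by rewrite -(dm_TA dV) PoszD addrAC subrr add0r.
have -> : T k (phi b) = T (k + l)%N (T (- l%:Z) (phi b)).
  by rewrite -(dm_TA dV) PoszD addrK.
by rewrite -(dm_TD dV) subrK.
Qed.

(** The maximum of the exponents that [dm_eq] gives for the finitely many rows works for all of
    them. *)
Lemma dm_mx_eq p (M N : 'M[nat]_(p, n)) :
  (forall a, phi (a *m M) = phi (a *m N)) ->
  exists k, M *m A ^+ k = N *m A ^+ k.
Proof.
move=> MN; have /choice[k kP] j := dm_eq dV (MN (delta_mx 0 j)).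
exists (\max_j k j); apply/row_matrixP => j.
have kj : (k j <= \max_i k i)%N by apply: leq_bigmax.
by rewrite !rowE !mulmxA -(subnKC kj) exprD !mulmxA kP.
Qed.

(** By [dm_rep] an element is determined by the image of [phi], the shifts and addition. *)
Lemma dm_rigid (h : V -> V) : {morph h : x y / x + y} ->
  (forall i x, h (T i x) = T i (h x)) -> (forall a, h (phi a) = phi a) ->
  h =1 id.
Proof.
move=> hD hT hphi x; have [k [a [b e]]] := dm_rep x.
apply: (can_inj (dm_TK k)); apply: (addIr (phi b)).
by rewrite -hT -[in LHS](hphi b) -hD e hphi.
Qed.

End DimensionModule.

(** * Maps of dimension modules and intertwining matrices *)

Section ShiftEquivalence.
Variables (V : zmodType) (T : int -> V -> V) (posV : V -> Prop).
Variables (n : nat) (A : 'M[nat]_n) (phi : 'rV[nat]_n -> V).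
Hypothesis dV : dimension_module T posV A phi.
Variables (W : zmodType) (U : int -> W -> W) (posW : W -> Prop).
Variables (m : nat) (B : 'M[nat]_m) (psi : 'rV[nat]_m -> W).
Hypothesis dW : dimension_module U posW B psi.

(** If [T k x = phi a - phi b], then [f x] has to be the [y] with
    [U k y = psi (a *m R) - psi (b *m R)]. The intertwining relation makes this independent of [k],
    [a] and [b]. *)
Lemma dm_map (R : 'M[nat]_(n, m)) : A *m R = R *m B ->
  exists f : V -> W, [/\ {morph f : x y / x + y},
    forall i x, f (T i x) = U i (f x) & forall a, f (phi a) = psi (a *m R)].
Proof.
move=> AR.
pose rel x y := exists (k : nat) a b,
  T k x + phi b = phi a /\ U k y + psi (b *m R) = psi (a *m R).
(* Two representations are compared after passing to a common, larger shift. *)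
have raise x y (k : nat) a b (l : nat) :
    T k x + phi b = phi a -> U k y + psi (b *m R) = psi (a *m R) ->
    T (l%:Z + k%:Z) x + phi (b *m A ^+ l) = phi (a *m A ^+ l) /\
    U (l%:Z + k%:Z) y + psi (b *m A ^+ l *m R) = psi (a *m A ^+ l *m R).
  move=> e e'; rewrite -!mulmxA (intertwine_exp l AR) !mulmxA.
  rewrite -!(dm_TX dV) -!(dm_TX dW) (dm_TA dV) (dm_TA dW).
  by rewrite -(dm_TD dV) -(dm_TD dW) e e'.
have tot x : exists y, rel x y.
  have [k [a [b e]]] := dm_rep dV x.
  exists (U (- k%:Z) (psi (a *m R) - psi (b *m R))), k, a, b; split=> //.
  by rewrite (dm_TNK dW) subrK.
have uniq x y z : rel x y -> rel x z -> y = z.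
  move=> [k [a [b [e e']]]] [l [c [d [g g']]]].
  have [{}e {}e'] := raise _ _ _ _ _ l e e'.
  have [{}g {}g'] := raise _ _ _ _ _ k g g'.
  rewrite [k%:Z + _]addrC in g g'.
  have h : phi (a *m A ^+ l + d *m A ^+ k) = phi (c *m A ^+ k + b *m A ^+ l).
    by rewrite !(dm_phiD dV) -e -g addrAC.
  (* An equality in [V] becomes one of row vectors after a power of [A]; these can be multiplied by
     [R], and the power, now of [B], is undone in [W] by a shift. *)
  have {h}[i h] := dm_eq dV h.
  have {}h : psi ((a *m A ^+ l + d *m A ^+ k) *m R) =
             psi ((c *m A ^+ k + b *m A ^+ l) *m R).
    apply: (can_inj (dm_TK dW i)); rewrite !(dm_TX dW).
    by rewrite -!mulmxA -(intertwine_exp i AR) !mulmxA h.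
  move: h; rewrite !mulmxDl !(dm_phiD dW) -e' -g' addrAC => /addIr/addIr.
  exact: (can_inj (dm_TK dW _)).
have [f fP] := choice tot; exists f; split.
- move=> x y; apply: uniq (fP _) _.
  have [k [a [b [e e']]]] := fP x; have [l [c [d [g g']]]] := fP y.
  have [{}e {}e'] := raise _ _ _ _ _ l e e'.
  have [{}g {}g'] := raise _ _ _ _ _ k g g'.
  rewrite [k%:Z + _]addrC in g g'.
  exists (l + k)%N, (a *m A ^+ l + c *m A ^+ k), (b *m A ^+ l + d *m A ^+ k).
  rewrite !mulmxDl !(dm_phiD dV) !(dm_phiD dW) (dm_TD dV) (dm_TD dW) PoszD.
  by rewrite addrACA e g addrACA e' g'.
- have fT (l : nat) x : f (T l x) = U l (f x).
    apply: uniq (fP _) _; have [k [a [b [e e']]]] := fP x.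
    have [{}e {}e'] := raise _ _ _ _ _ l e e'.
    exists k, (a *m A ^+ l), (b *m A ^+ l).
    by rewrite -(dm_TA dV) -(dm_TA dW) [k%:Z + _]addrC.
  case=> l x; first exact: fT.
  by apply: (can_inj (dm_TK dW l.+1)); rewrite NegzE (dm_TNK dW) -fT (dm_TNK dV).
- move=> a; apply: uniq (fP _) _; exists 0%N, a, 0.
  rewrite (dm_T0 dV) (dm_T0 dW) mul0mx (dm_phi0 dV) (dm_phi0 dW).
  by rewrite !addr0.
Qed.

(** Positivity of [f] yields a nonnegative matrix: each unit row is sent to a shift of some [psi r],
    and the rows [r], at a common shift, make up the matrix. *)
Lemma dm_map_mx (f : V -> W) : {morph f : x y / x + y} ->
  (forall i x, f (T i x) = U i (f x)) -> (forall x, posV x -> posW (f x)) ->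
  exists (k : nat) (R : 'M[nat]_(n, m)), A *m R = R *m B /\
    forall a, U k (f (phi a)) = psi (a *m R).
Proof.
move=> fD fT fpos.
have /choice[kr krP] j : exists kr : nat * 'rV[nat]_m,
    f (phi (delta_mx 0 j)) = U (- kr.1%:Z) (psi kr.2).
  have /(dm_pos dW)[k [r e]] := fpos _ (dm_phi_pos dV (delta_mx 0 j)).
  by exists (k, r).
pose k := \max_j (kr j).1.
(* The power of [B] moves row [j] from its own shift [(kr j).1] to the common shift [k]. *)
pose R := \matrix_j ((kr j).2 *m B ^+ (k - (kr j).1)).
have RP a : U k (f (phi a)) = psi (a *m R).
  have f0 : f 0 = 0 by apply: (addrI (f 0)); rewrite -fD !addr0.
  have U0 : U k 0 = 0 by apply: (addrI (U k 0)); rewrite -(dm_TD dW) !addr0.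
  move: a; apply: additive_rV_nat.
  - by rewrite (dm_phi0 dV) f0 U0.
  - by rewrite mul0mx (dm_phi0 dW).
  - by move=> a b; rewrite (dm_phiD dV) fD (dm_TD dW).
  - by move=> a b; rewrite mulmxDl (dm_phiD dW).
  move=> j; rewrite krP -rowE rowK -(dm_TX dW) -(dm_TA dW).
  by rewrite subzn // /k; apply: (leq_bigmax (F := fun j => (kr j).1)).
have [l e] : exists l, (A *m R) *m B ^+ l = (R *m B) *m B ^+ l.
  apply: (dm_mx_eq dW) => a.
  rewrite !mulmxA -RP -(dm_T1 dV) fT -(dm_T1 dW) -RP.
  by rewrite -!(dm_TA dW) addrC.
(* [R] intertwines only up to a factor [B ^+ l]; absorbing it into [R] makes the relation exact and
   costs [l] further shifts. *)
exists (l + k)%N, (R *m B ^+ l); split.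
  by rewrite mulmxA e -!mulmxA -[B *m _]exprS exprSr.
by move=> a; rewrite PoszD (dm_TA dW) RP (dm_TX dW) mulmxA.
Qed.

End ShiftEquivalence.

(** * Shift equivalence and ordered isomorphism *)

Section ShiftEquivalenceIso.
Variables (V : zmodType) (T : int -> V -> V) (posV : V -> Prop).
Variables (n : nat) (A : 'M[nat]_n) (phi : 'rV[nat]_n -> V).
Hypothesis dV : dimension_module T posV A phi.
Variables (W : zmodType) (U : int -> W -> W) (posW : W -> Prop).
Variables (m : nat) (B : 'M[nat]_m) (psi : 'rV[nat]_m -> W).
Hypothesis dW : dimension_module U posW B psi.

Lemma shift_equivalent_iso : shift_equivalent A B ->
  exists (f : V -> W) (g : W -> V), [/\ {morph f : x y / x + y},
    forall i x, f (T i x) = U i (f x), cancel f g, cancel g f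
    & (forall x, posV x -> posW (f x)) /\ (forall y, posW y -> posV (g y))].
Proof.
move=> [R [S [l [_ RS SR AR SA]]]].
have [f [fD fT fphi]] := dm_map dV dW AR.
have [g [gD gT gpsi]] := dm_map dW dV (esym SA).
exists f, (fun y => T (- l%:Z) (g y)); split=> //.
- apply: (dm_rigid dV) => [x y|i x|a].
  + by rewrite fD gD (dm_TD dV).
  + by rewrite fT gT -!(dm_TA dV) addrC.
  + by rewrite fphi gpsi -mulmxA -RS -(dm_TX dV) (dm_TK dV).
- apply: (dm_rigid dW) => [x y|i x|a].
  + by rewrite gD (dm_TD dV) fD.
  + by rewrite gT !fT -!(dm_TA dW) addrC.
  + by rewrite gpsi fT fphi -mulmxA -SR -(dm_TX dW) (dm_TK dW).
- split=> x.
    move=> /(dm_pos dV)[k [a ->]]; rewrite fT fphi.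
    by apply/(dm_T_pos dW)/(dm_phi_pos dW).
  move=> /(dm_pos dW)[k [a ->]]; rewrite gT gpsi.
  by do 2!apply: (dm_T_pos dV); apply: (dm_phi_pos dV).
Qed.

(** The matrices of [f] and [g] have products equal to powers of [A] and [B] only up to further
    powers. Multiplying [S] by a large power of [A] makes both equalities exact. *)
Lemma iso_shift_equivalent (f : V -> W) (g : W -> V) :
  {morph f : x y / x + y} -> (forall i x, f (T i x) = U i (f x)) ->
  cancel f g -> cancel g f ->
  (forall x, posV x -> posW (f x)) -> (forall y, posW y -> posV (g y)) ->
  shift_equivalent A B.
Proof.
move=> fD fT fK gK fpos gpos.
have gD : {morph g : x y / x + y}.
  by move=> x y; apply: (can_inj fK); rewrite fD !gK.
have gT i y : g (U i y) = T i (g y) by apply: (can_inj fK); rewrite fT !gK.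
have [k [R [AR RP]]] := dm_map_mx dV dW fD fT fpos.
have [l [S [BS SP]]] := dm_map_mx dW dV gD gT gpos.
have [i RS] : exists i, (R *m S) *m A ^+ i = A ^+ (l + k) *m A ^+ i.
  apply: (dm_mx_eq dV) => a.
  by rewrite mulmxA -SP -RP gT fK -(dm_TA dV) -(dm_TX dV) PoszD.
have [j SR] : exists j, (S *m R) *m B ^+ j = B ^+ (l + k) *m B ^+ j.
  apply: (dm_mx_eq dW) => a.
  by rewrite mulmxA -RP -SP fT gK -(dm_TA dW) -(dm_TX dW) PoszD addrC.
have expmxD p (M : 'M[nat]_p) c d : M ^+ (c + d) = M ^+ c *m M ^+ d := exprD M c d.
(* [N] exceeds both [i] and [j], and the successor keeps the lag positive. *)
pose N := (i + j.+1)%N; have NE : N = (j + i.+1)%N by rewrite /N addnS addnC addnS.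
exists R, (S *m A ^+ N), (l + k + N)%N; split=> //.
- by rewrite /N !addnS.
- by rewrite (expmxD _ _ (l + k)%N) /N (expmxD _ _ i) !mulmxA RS.
- rewrite -mulmxA (intertwine_exp N AR) (expmxD _ _ (l + k)%N) NE (expmxD _ _ j).
  by rewrite !mulmxA SR.
- by rewrite mulmxA BS -!mulmxA -[A *m _]exprS -[_ *m A]exprSr.
Qed.

End ShiftEquivalenceIso.

(** * The graded K-group as a dimension module *)

Section GradedK0.
Variables (K : fieldType) (E : digraph).
Hypothesis hE : no_sinks E.
Local Notation L := (leavitt_gr K E).
Local Notation A := (adjmx E).
Local Notation N := #|vert E|.

Definition vphi (a : 'rV[nat]_N) : Vgr L :=
  \sum_j vclass (vgrproj K (enum_val j)) *+ a 0 j.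

Lemma vphiD a b : vphi (a + b) = vphi a + vphi b.
Proof. by rewrite -big_split; apply: eq_bigr => j _; rewrite mxE mulrnDr. Qed.

Lemma vphi_mult (I : finType) (vs : I -> vert E) :
  vphi (mult vs) = \sum_i vclass (vgrproj K (vs i)).
Proof.
rewrite /vphi; under eq_bigr => j _ do rewrite mxE -sumrMnr.
rewrite exchange_big; apply: eq_bigr => i _ /=.
rewrite (bigD1 (enum_rank (vs i))) //= enum_rankK eqxx big1 ?addr0 // => j.
by case: (vs i =P enum_val j) => [->|//]; rewrite enum_valK eqxx.
Qed.

Lemma mult_surj (a : 'rV[nat]_N) :
  exists (I : finType) (vs : I -> vert E), mult vs = a.
Proof.
exists {j : 'I_N & 'I_(a 0 j)}, (fun x => enum_val (tag x)).
apply/rowP => j; rewrite mxE.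
transitivity (\sum_(i < N) \sum_(k < a 0 i) (enum_val i == enum_val j : nat)).
  by rewrite sig_big_dep.
rewrite (bigD1 j) //= eqxx sumr_const card_ord natn big1 ?addr0 // => i ij.
by rewrite (inj_eq enum_val_inj) (negPf ij) sumr_const mul0rn.
Qed.

Lemma vshift0n (v : Vgr L) : vshift (- 0) v = v.
Proof. by rewrite oppr0 vshift_0. Qed.

(** One module has a basis of type [a] in degree 0 and, refined, one of type [a *m A ^+ n] in degree
    [n]; its class is computed from both. *)
Lemma vphiX (n : nat) a : vshift n (vphi a) = vphi (a *m A ^+ n).
Proof.
have [I [vs <-]] := mult_surj a; have [P [p [bp _]]] := std_exists K vs.
have [I' [vs' [p' [bp' _ _ mE]]]] := refine hE n bp.
have := gbasis_vclass bp; rewrite vshift0n vphi_mult => <-.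
rewrite (gbasis_vclass bp') add0r -vshift_add addrN vshift_0.
by rewrite -mE vphi_mult.
Qed.

(** An isomorphism carries a basis of one model to a second basis of the other, to which
    [gbasis_mult] applies. *)
Lemma vphi_eq a b : vphi a = vphi b -> exists k, a *m A ^+ k = b *m A ^+ k.
Proof.
have [I [vs <-]] := mult_surj a; have [P [p [bp cP]]] := std_exists K vs.
have [J [ws <-]] := mult_surj b; have [Q [q [bq cQ]]] := std_exists K ws.
rewrite !vphi_mult -cP -cQ => /vclassP/gr_iso_sym[f [[g fK gK] cf]].
apply: (gbasis_mult hE bp (q := f \o q)); split=> [j|j|x|c].
- by apply/cf; apply: gb_comp bq _.
- by rewrite -linear_ract (gb_vert bq).
- have [c e] := gb_span bq (g x); exists c.
  by rewrite -(gK x) e linear_ract_sum.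
- rewrite -linear_ract_sum -(raddf0 f) => /(can_inj fK); exact: (gb_free bq).
Qed.

Lemma vphi_rep (v : Vgr L) : exists (k : nat) a, v = vshift (- k%:Z) (vphi a).
Proof.
have [D [n [vs [p bp]]]] := gbasis_exists hE (vrep v).
exists D, (mult vs); rewrite vphi_mult -(gbasis_vclass bp).
by rewrite vrepK.
Qed.

Lemma K0gr_shift_class j (v : Vgr L) :
  K0gr_shift j (gc_class v : K0gr L) = gc_class (vshift j v) :> K0gr L.
Proof. exact: (gc_map_class (vshiftD j)). Qed.

Definition K0phi (a : 'rV[nat]_N) : K0gr L := gc_class (vphi a).

Lemma K0gr_dimension_module :
  dimension_module (@K0gr_shift L) (@K0gr_pos L) A K0phi.
Proof.
split.
- exact: K0gr_shift0.
- exact: K0gr_shiftA.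
- exact: K0gr_shiftD.
- by move=> a b; rewrite /K0phi vphiD gc_classD.
- by move=> a; rewrite /K0phi K0gr_shift_class (vphiX 1) expr1.
(* Equality in the completion holds up to a summand [v]. After a shift [v] is the [vphi] of a row
   [c], whose contribution cancels in the natural number entries. *)
- move=> a b /gc_classP[v]; have [k [c ->]] := vphi_rep v.
  move=> /(congr1 (vshift k)); rewrite !vshiftD !vphiX -!vshift_add addrN vshift_0.
  rewrite -!vphiD => /vphi_eq[l]; rewrite !mulmxDl -!mulmxA => e.
  exists (k + l)%N; rewrite exprD; apply/rowP => j.
  by apply: (@addIn ((c *m A ^+ l) 0 j)); move/rowP/(_ j): e; rewrite !mxE.
- move=> x; split=> [[v _ <-]|[k [a ->]]].
    have [k [a ->]] := vphi_rep v; exists k, a.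
    by rewrite /K0phi K0gr_shift_class.
  by exists (vshift (- k%:Z) (vphi a)) => //; rewrite -K0gr_shift_class.
- move=> x; have [v [w ->]] := gc_class_surj x; exists (gc_class v), (gc_class w).
  by split=> //; [exists v|exists w].
Qed.

End GradedK0.

(** * Linearity over the Laurent polynomials, and the equivalence *)

Lemma laurentX_scale (R : gradedRing) j (x : K0gr R) :
  laurentX j *: x = K0gr_shift j x.
Proof.
have [v [w ->]] := gc_class_surj x; rewrite -(vrepK v) -(vrepK w).
rewrite scalerBr !K0gr_laurentX /K0gr_shift (gc_mapE (vshiftD j)).
by rewrite !vclass_gshift.
Qed.

(** A fraction p / x^n acts as an integer combination of shifts followed by the shift by [- n], and
    [f] commutes with both. *)
Lemma shift_linear (R S : gradedRing) (f : K0gr R -> K0gr S) :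
  {morph f : x y / x + y} ->
  (forall i x, f (K0gr_shift i x) = K0gr_shift i (f x)) -> linear f.
Proof.
move=> fD fT.
have f0 : f 0 = 0 by apply: (addrI (f 0)); rewrite -fD !addr0.
have fN x : f (- x) = - f x by apply: (addrI (f x)); rewrite -fD !subrr.
have fMn x n : f (x *+ n) = f x *+ n.
  by elim: n => [|n IH]; rewrite ?mulr0n // !mulrS fD IH.
have fMz x (z : int) : f (x *~ z) = f x *~ z.
  by case: z => n; rewrite ?NegzE ?mulrNz -?pmulrn ?fN fMn.
move=> q x y; rewrite fD; congr (_ + _).
have [p [_ [n [qE _]]]] := laurent_common q q.
have ER := laurent_actE (@K0gr_shift0 R) (@K0gr_shiftA R) (@K0gr_shiftD R) x qE.
have ES := laurent_actE (@K0gr_shift0 S) (@K0gr_shiftA S) (@K0gr_shiftD S) (f x) qE.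
rewrite -[LHS]/(f (laurent_act _ _ _)) -[RHS]/(laurent_act _ _ _) ER ES fT.
congr (K0gr_shift _ _); rewrite /peval (big_morph f fD f0).
by apply: eq_bigr => i _; rewrite fMz fT.
Qed.

Theorem corollary9 (K : fieldType) (E F : digraph)
    (hE : no_sinks E) (hF : no_sinks F) :
  shift_equivalent (adjmx E) (adjmx F) <->
  K0gr_order_iso (leavitt_gr K E) (leavitt_gr K F).
Proof.
have dE := K0gr_dimension_module K hE; have dF := K0gr_dimension_module K hF.
split=> [/(shift_equivalent_iso dE dF)[f [g [fD fT fK gK [fpos gpos]]]]|].
  have lf := shift_linear fD fT.
  pose f' : {linear K0gr (leavitt_gr K E) -> K0gr (leavitt_gr K F)} :=
    HB.pack f (GRing.isLinear.Build _ _ _ _ f lf).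
  exists f'; split; first by exists g.
  apply/seteqP; split=> [_ [x /fpos fx <-] //|y /gpos gy].
  by exists (g y) => //; apply: gK.
move=> [f [[g fK gK] fpos]].
(* Linearity applied to the monomials x^i. *)
have fT i x : f (K0gr_shift i x) = K0gr_shift i (f x).
  by rewrite -!laurentX_scale linearZ.
apply: (iso_shift_equivalent dE dF (raddfD f) fT fK gK) => [x px|y py].
  by rewrite -fpos; exists x.
by move: py; rewrite -fpos => -[x px <-]; rewrite fK.
Qed.
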